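(* Let $p\ge 0$ and $q\ge 1$ be fixed polynomial degrees and let $f\in L^2(\Omega)$. Let $(\boldsymbol\sigma_{\mathrm{LS}},u_{\mathrm{LS}})\in(\boldsymbol{RTN}_p(\mathcal{T})\cap\boldsymbol H(\mathrm{div},\Omega))\times(\mathcal{P}_q(\mathcal{T})\cap H^1_0(\Omega))$ be the least-squares mixed finite element solution, i.e. $$(\boldsymbol\sigma_{\mathrm{LS}}+\nabla u_{\mathrm{LS}},\nabla v_{\mathcal{T}})=0\qquad\forall v_{\mathcal{T}}\in\mathcal{P}_q(\mathcal{T})\cap H^1_0(\Omega),$$ $$h_\Omega^2(\nabla\cdot\boldsymbol\sigma_{\mathrm{LS}},\nabla\cdot\boldsymbol p_{\mathcal{T}})+(\boldsymbol\sigma_{\mathrm{LS}}+\nabla u_{\mathrm{LS}},\boldsymbol p_{\mathcal{T}})=h_\Omega^2(f,\nabla\cdot\boldsymbol p_{\mathcal{T}})\qquad\forall\boldsymbol p_{\mathcal{T}}\in\boldsymbol{RTN}_p(\mathcal{T})\cap\boldsymbol H(\mathrm{div},\Omega),$$ approximating the solution $(\boldsymbol\sigma,u)\in\boldsymbol H(\mathrm{div},\Omega)\times H^1_0(\Omega)$ of $$(\boldsymbol\sigma+\nabla u,\nabla v)=0\qquad\forall v\in H^1_0(\Omega),$$ $$h_\Omega^2(\nabla\cdot\boldsymbol\sigma,\nabla\cdot\boldsymbol p)+(\boldsymbol\sigma+\nabla u,\boldsymbol p)=h_\Omega^2(f,\nabla\cdot\boldsymbol p)\qquad\forall\boldsymbol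 p\in\boldsymbol H(\mathrm{div},\Omega).$$ Then there exists a generic constant $C$, at most equal to $17$, such that $$\|\boldsymbol\sigma-\boldsymbol\sigma_{\mathrm{LS}}\|+\|\nabla(u-u_{\mathrm{LS}})\|\le C\bigg(\min_{\substack{\boldsymbol v_{\mathcal T}\in\boldsymbol{RTN}_p(\mathcal{T})\cap\boldsymbol H(\mathrm{div},\Omega)\\ \nabla\cdot\boldsymbol v_{\mathcal T}=\Pi^p_{\mathcal{T}}(\nabla\cdot\boldsymbol\sigma)}}\|\boldsymbol\sigma-\boldsymbol v_{\mathcal T}\|+\min_{v_{\mathcal{T}}\in\mathcal{P}_q(\mathcal{T})\cap H^1_0(\Omega)}\|\nabla(u-v_{\mathcal{T}})\|\bigg).$$
   Context: $\Omega\subset\mathbb{R}^d$, $d\in\{2,3\}$, is an open, bounded, connected polygon or polyhedron with Lipschitz boundary; $h_\Omega$ is its diameter. $\mathcal{T}$ is a conforming simplicial, possibly locally refined, mesh of $\Omega$: $\overline\Omega=\bigcup_{K\in\mathcal{T}}K$, each $K$ a closed simplex, and two different simplices intersect in the empty set or a common vertex, edge, or face. $(\cdot,\cdot)$ and $\|\cdot\|$ are the $L^2(\Omega)$ inner product and norm (scalar or vector valued). $\boldsymbol H(\mathrm{div},\Omega):=\{\boldsymbol v\in L^2(\Omega;\mathbb{R}^d):\nabla\cdot\boldsymbol v\in L^2(\Omega)\}$; no boundary condition is imposed on fluxes (the case $\Gamma_{\mathrm N}=\emptyset$). $\mathcal{P}_m(K)$: polynomials of total degree at most $m$ on $K$;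 $\mathcal{P}_m(\mathcal{T})$: functions in $L^2(\Omega)$ whose restriction to each $K\in\mathcal{T}$ is in $\mathcal{P}_m(K)$; $\boldsymbol{RTN}_p(K):=\mathcal{P}_p(K;\mathbb{R}^d)+\boldsymbol x\,\mathcal{P}_p(K)$; $\boldsymbol{RTN}_p(\mathcal{T}):=\{\boldsymbol v_{\mathcal T}\in L^2(\Omega;\mathbb{R}^d):\boldsymbol v_{\mathcal T}|_K\in\boldsymbol{RTN}_p(K)\ \forall K\in\mathcal{T}\}$; $\Pi^p_{\mathcal{T}}$ is the $L^2$-orthogonal projection onto $\mathcal{P}_p(\mathcal{T})$. *)

(* Defs.v *)
From HB Require Import structures.
From mathcomp Require Import all_boot all_order all_algebra.
From mathcomp Require Import all_classical all_reals all_analysis.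
(* Notations and names of mpoly clash with those of MathComp-Analysis. *)
From mathcomp Require Import (coercions, canonicals) mpoly.

Set Implicit Arguments.
Unset Strict Implicit.
Unset Printing Implicit Defensive.
Import Order.TTheory GRing.Theory Num.Theory.
Import numFieldNormedType.Exports.
Local Open Scope classical_set_scope.
Local Open Scope ring_scope.

(* Lebesgue measure on R^n = 'rV[R]_n.  The sigma-algebra is generated by the
   coordinates (as for n.-tuple in the library), i.e. it is the Borel one.
   Every L^2 class has a Borel representative, and `{ae mu, ...}' accepts any
   subset of a Borel null set, so nothing is lost by not completing it. *)
Section measurable_rV.
Context {R : realType} {n : nat}.

Let coord (i : 'I_n) (x : 'rV[R]_n) : R := x 0 i.

Let rV_set0 : g_sigma_preimage coord set0.
Proof. exact: sigma_algebra0. Qed.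

Let rV_setC A : g_sigma_preimage coord A -> g_sigma_preimage coord (~` A).
Proof. exact: sigma_algebraC. Qed.

Let rV_bigcup (F : _^nat) : (forall i, g_sigma_preimage coord (F i)) ->
  g_sigma_preimage coord (\bigcup_i (F i)).
Proof. exact: sigma_algebra_bigcup. Qed.

Definition rV_display : measure_display.
Proof. exact: default_measure_display. Qed.

HB.instance Definition _ := @isMeasurable.Build rV_display
  'rV[R]_n (g_sigma_preimage coord) rV_set0 rV_setC rV_bigcup.

Lemma measurable_coord (i : 'I_n) :
  measurable_fun [set: 'rV[R]_n] (fun x : 'rV[R]_n => x 0 i).
Proof.
move=> _ Y mY; rewrite setTI; apply: sub_sigma_algebra => /=.
rewrite -bigcup_seq/=; exists i => /=; first by rewrite mem_index_enum.
by exists Y => //; rewrite setTI.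
Qed.

Lemma measurable_fun_rV d (T : measurableType d) (f : T -> 'rV[R]_n) :
  (forall i, measurable_fun [set: T] (fun x => f x 0 i)) ->
  measurable_fun [set: T] f.
Proof.
move=> mf _ A mA; rewrite setTI.
have sub : g_sigma_preimage coord `<=` [set B | measurable (f @^-1` B)];
  last exact: sub.
apply: smallest_sub.
  split; first by rewrite /= preimage_set0.
  - move=> B mB /=; rewrite setTD -preimage_setC.
    by apply: measurableC; apply: mB.
  - move=> F mF /=; rewrite preimage_bigcup.
    by apply: bigcup_measurable => k _; apply: mF.
rewrite -bigcup_seq/= => _ [i _ [B mB <-]] /=.
rewrite setTI -[X in measurable X]setTI; exact: mf.
Qed.

End measurable_rV.

Section lebesgue_rV.
Context {R : realType}.

Definition cons_rV n (xv : R * 'rV[R]_n) : 'rV[R]_n.+1 :=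
  \row_i (if unlift ord0 i is Some j then xv.2 0 j else xv.1).

Lemma measurable_cons_rV n : measurable_fun setT (@cons_rV n).
Proof.
apply: measurable_fun_rV => i.
case: (unliftP ord0 i) => [j|] ->.
  rewrite (_ : (fun _ => _) = (fun v : 'rV[R]_n => v 0 j) \o snd).
    exact: measurableT_comp (measurable_coord j) measurable_snd.
  by apply/funext => x /=; rewrite mxE liftK.
rewrite (_ : (fun _ => _) = fst); first exact: measurable_fst.
by apply/funext => x /=; rewrite mxE unlift_none.
Qed.

Let uncons_rV n (v : 'rV[R]_n.+1) : R * 'rV[R]_n :=
  (v 0 ord0, \row_j v 0 (lift ord0 j)).

Let measurable_uncons_rV n : measurable_fun setT (@uncons_rV n).
Proof.
apply/measurable_fun_pairP; split; first exact: measurable_coord.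
apply: measurable_fun_rV => j.
rewrite (_ : (fun _ => _) = (fun v : 'rV[R]_n.+1 => v 0 (lift ord0 j))).
  exact: measurable_coord.
by apply/funext => v /=; rewrite mxE.
Qed.

Let cons_rVK n : cancel (@cons_rV n) (@uncons_rV n).
Proof.
move=> [x v]; congr (_, _); first by rewrite mxE unlift_none.
by apply/rowP => j; rewrite !mxE liftK.
Qed.

Section step.
Context {n : nat} (m : {sigma_finite_measure set 'rV[R]_n -> \bar R}).

Definition lebesgue_step : set 'rV[R]_n.+1 -> \bar R :=
  pushforward (@lebesgue_measure R \x m)%E (@cons_rV n).

Let step0 : lebesgue_step set0 = 0%E.
Proof. by rewrite /lebesgue_step /pushforward preimage_set0 measure0. Qed.

Let step_ge0 A : (0 <= lebesgue_step A)%E.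
Proof. by rewrite /lebesgue_step /pushforward; exact: measure_ge0. Qed.

Let step_sigma_additive : semi_sigma_additive lebesgue_step.
Proof.
pose mu : {measure set _ -> \bar R} :=
  measure_function_pushforward__canonical__measure_function_Measure
    (@lebesgue_measure R \x m)%E (@measurable_cons_rV n).
exact: (@measure_semi_sigma_additive _ _ _ mu).
Qed.

HB.instance Definition _ := isMeasure.Build _ _ _ lebesgue_step
  step0 step_ge0 step_sigma_additive.

Let step_sigma_finite : sigma_finite setT lebesgue_step.
Proof.
have /sigma_finiteP[F [TF ndF Foo]] := sigma_finiteT (@lebesgue_measure R).
have /sigma_finiteP[G [TG ndG Goo]] := sigma_finiteT m.
exists (fun k => @uncons_rV n @^-1` (F k `*` G k)).
  rewrite -preimage_bigcup [X in _ @^-1` X](_ : _ = setT) ?preimage_setT//.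
  apply/seteqP; split=> // -[x v] _.
  have : setT x by []. rewrite TF => -[k _ Fkx].
  have : setT v by []. rewrite TG => -[l _ Glv].
  exists (maxn k l) => //; split => /=.
    by move: x Fkx; exact/subsetPset/ndF/leq_maxl.
  by move: v Glv; exact/subsetPset/ndG/leq_maxr.
move=> k; have [mF Fk] := Foo k; have [mG Gk] := Goo k; split.
  rewrite -[X in measurable X]setTI; apply: measurable_uncons_rV => //.
  exact: measurableX.
rewrite /lebesgue_step /pushforward -comp_preimage.
rewrite (_ : _ \o _ = id); last by apply/funext => x; exact: cons_rVK.
by rewrite preimage_id product_measure1E// lte_mul_pinfty// ge0_fin_numE.
Qed.

HB.instance Definition _ := Measure_isSigmaFinite.Build _ _ _ lebesgue_step
  step_sigma_finite.

End step.

Fixpoint lebesgue_rV (n : nat) :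
    {sigma_finite_measure set 'rV[R]_n -> \bar R} :=
  if n is n'.+1 then lebesgue_step (lebesgue_rV n') else dirac (0 : 'rV[R]_0).

End lebesgue_rV.

Section euclidean.
Context {R : realType} {d : nat}.
Implicit Types (x y : 'rV[R]_d) (Omega : set 'rV[R]_d).

Definition dot x y : R := \sum_i x 0 i * y 0 i.

(* The library's `|x| on 'rV[R]_d is the sup norm, hence this definition. *)
Definition enorm x : R := Num.sqrt (dot x x).

Definition diameter Omega : R :=
  sup [set enorm (x - y) | x in Omega & y in Omega].

(* Omega is, near each boundary point, the set lying above the graph of a
   Lipschitz function over the hyperplane orthogonal to some unit vector nu.
   The function gamma is only ever evaluated on that hyperplane. *)
Definition lipschitz_boundary Omega : Prop :=
  forall x, (closure Omega `\` interior Omega) x ->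
  exists (nu : 'rV[R]_d) (gamma : 'rV[R]_d -> R) (L r : R),
  [/\ dot nu nu = 1, 0 < r,
      forall y z, `|gamma y - gamma z| <= L * enorm (y - z) &
      forall y, enorm (y - x) < r ->
        (Omega y <-> gamma (y - dot y nu *: nu) < dot y nu)].

(* Polygon (d = 2) or polyhedron (d = 3): the boundary lies in finitely many
   hyperplanes {x | dot x a = b}. *)
Definition polytopal Omega : Prop :=
  exists s : seq ('rV[R]_d * R),
    (forall ab, ab \in s -> ab.1 != 0) /\
    closure Omega `\` interior Omega
      `<=` [set x | exists2 ab, ab \in s & dot x ab.1 = ab.2].

Record polytopal_domain Omega : Prop := PolytopalDomain {
  domain_nonempty : Omega !=set0;
  domain_open : open Omega;
  domain_bounded : bounded_set Omega;
  domain_connected : connected Omega;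
  domain_polytopal : polytopal Omega;
  domain_lipschitz : lipschitz_boundary Omega }.

(* A d-simplex is given by the (d+1) x d matrix whose rows are its vertices. *)
Definition nondegenerate (K : 'M[R]_(d.+1, d)) : bool :=
  row_free (row_mx K (const_mx 1 : 'cV[R]_d.+1)).

Definition face (K : 'M[R]_(d.+1, d)) (S : {set 'I_d.+1}) : set 'rV[R]_d :=
  [set l *m K | l in [set l : 'rV[R]_d.+1 |
    [/\ forall i, 0 <= l 0 i, forall i, i \notin S -> l 0 i = 0
      & \sum_i l 0 i = 1]]].

Definition simplex (K : 'M[R]_(d.+1, d)) : set 'rV[R]_d :=
  face K (finset.setTfor 'I_d.+1).

(* Two entries of T that list the same vertices in different orders violate
   mesh_conforming, because the shared face must be proper. *)
Record conforming_mesh Omega (T : seq 'M[R]_(d.+1, d)) : Prop :=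
  ConformingMesh {
  mesh_nondegenerate : forall K, K \in T -> nondegenerate K;
  mesh_cover : closure Omega = \bigcup_(K in [set` T]) simplex K;
  mesh_conforming : forall K K', K \in T -> K' \in T -> K != K' ->
    simplex K `&` simplex K' = set0 \/
    exists S S' : {set 'I_d.+1},
      [/\ S \proper finset.setTfor 'I_d.+1, S' \proper finset.setTfor 'I_d.+1,
          simplex K `&` simplex K' = face K S & face K S = face K' S'] }.

End euclidean.

Section function_spaces.
Context {R : realType} {d : nat} (Omega : set 'rV[R]_d).
Implicit Types (f g u w phi : 'rV[R]_d -> R) (v G : 'rV[R]_d -> 'rV[R]_d).

Let mu := lebesgue_rV (R := R) d.

(* L^2 functions are represented by total functions on R^d, of which only the
   values on Omega, up to null sets, matter. *)
Definition L2 f : Prop :=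
  measurable_fun Omega f /\ mu.-integrable Omega (fun x => (f x ^+ 2)%:E).

Definition L2v v : Prop := forall i, L2 (fun x => v x 0 i).

Definition inner f g : R := \int[mu]_(x in Omega) (f x * g x).
Definition innerv v (v' : 'rV[R]_d -> 'rV[R]_d) : R :=
  \int[mu]_(x in Omega) dot (v x) (v' x).
Definition norm2 f : R := Num.sqrt (inner f f).
Definition norm2v v : R := Num.sqrt (innerv v v).

Definition pderiv (i : 'I_d) f : 'rV[R]_d -> R :=
  fun x => 'D_(delta_mx 0 i) f x.

Definition iter_pderiv (s : seq 'I_d) f := foldr pderiv f s.

Definition smooth f : Prop := forall s : seq 'I_d,
  continuous (iter_pderiv s f : 'rV[R]_d -> R) /\
  forall i x, derivable (iter_pderiv s f) x (delta_mx 0 i).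

Definition grad f : 'rV[R]_d -> 'rV[R]_d := fun x => \row_i pderiv i f x.

(* C_c^oo(Omega) *)
Definition test_function phi : Prop :=
  [/\ smooth phi, compact (closure [set x | phi x != 0])
    & closure [set x | phi x != 0] `<=` Omega].

Definition is_weak_grad u G : Prop := L2v G /\
  forall phi, test_function phi ->
  forall i, inner u (pderiv i phi) = - inner (fun x => G x 0 i) phi.

Definition is_weak_div v g : Prop := L2 g /\
  forall phi, test_function phi -> innerv v (grad phi) = - inner g phi.

(* Representatives of the weak gradient and divergence; junk value 0 when the
   function has none in L^2. *)
Definition wgrad u : 'rV[R]_d -> 'rV[R]_d := xget (fun=> 0) (is_weak_grad u).
Definition wdiv v : 'rV[R]_d -> R := xget (fun=> 0) (is_weak_div v).

Definition H1 : set ('rV[R]_d -> R) :=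
  [set u | L2 u /\ exists G, is_weak_grad u G].

(* Closure of C_c^oo(Omega) in H^1(Omega). *)
Definition H10 : set ('rV[R]_d -> R) :=
  [set u | H1 u /\ forall e : R, 0 < e ->
    exists phi, [/\ test_function phi,
      norm2 (fun x => u x - phi x) < e &
      norm2v (fun x => wgrad u x - grad phi x) < e]].

Definition Hdiv : set ('rV[R]_d -> 'rV[R]_d) :=
  [set v | L2v v /\ exists g, is_weak_div v g].

Definition polyfun (P : mpoly.mpoly d R) : 'rV[R]_d -> R :=
  fun x => mpoly.meval (fun i => x 0 i) P.

(* mmeasure mdeg P, i.e. msize P, is the total degree plus one. *)
Definition degree_le (m : nat) (P : mpoly.mpoly d R) : Prop :=
  (mpoly.mmeasure mpoly.mdeg P <= m.+1)%N.

Variable T : seq 'M[R]_(d.+1, d).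

Definition Pm (m : nat) : set ('rV[R]_d -> R) :=
  [set g | L2 g /\ forall K, K \in T -> exists2 P, degree_le m P &
    {ae mu, forall x, (Omega `&` simplex K) x -> g x = polyfun P x}].

Definition RTN (p : nat) : set ('rV[R]_d -> 'rV[R]_d) :=
  [set v | L2v v /\ forall K, K \in T ->
    exists (P : 'I_d -> mpoly.mpoly d R) (Q : mpoly.mpoly d R),
    [/\ forall i, degree_le p (P i), degree_le p Q &
    {ae mu, forall x, (Omega `&` simplex K) x ->
       v x = (\row_i polyfun (P i) x) + polyfun Q x *: x}]].

(* g = Pi^m_T f *)
Definition is_L2_projection (m : nat) f g : Prop :=
  Pm m g /\ forall q, Pm m q -> inner (fun x => f x - g x) q = 0.

(* (sigma, u) in V x U solves the least-squares problem posed in V x U. *)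
Definition least_squares_solution f (V : set ('rV[R]_d -> 'rV[R]_d))
    (U : set ('rV[R]_d -> R)) sigma u : Prop :=
  [/\ V sigma, U u,
      forall w, U w ->
        innerv (fun x => sigma x + wgrad u x) (wgrad w) = 0 &
      forall v, V v ->
        diameter Omega ^+ 2 * inner (wdiv sigma) (wdiv v)
          + innerv (fun x => sigma x + wgrad u x) v
        = diameter Omega ^+ 2 * inner f (wdiv v)].

End function_spaces.

(* Main.v *)
(* With eps = sigma_LS - v, delta = u_LS - w for arbitrary discrete v, w such
   that div v = Pi(div sigma), Galerkin orthogonality gives
     |eps + grad delta|^2 + h^2 |div eps|^2
       = (sigma - v + grad (u - w), eps + grad delta),
   because div (sigma - v) is orthogonal to div eps, which is a piecewise
   polynomial of degree p.  The norms of eps and grad delta separately follow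
   from |eps|^2 + |grad delta|^2 = |eps + grad delta|^2 + 2 (div eps, delta) and
   a Friedrichs inequality |delta| <= 2 h |grad delta|; together
   this yields the constant 6.

   Since weak gradients and divergences are arbitrary representatives, their
   linearity requires the fundamental lemma of the calculus of variations.  It
   is proved with the functions flat 0 (n f), which increase to the indicator of
   {f > 0} for smooth f: such sets form a pi-system generating the Borel
   sigma-algebra. *)
Require Import Defs.
From mathcomp Require Import all_boot all_order all_algebra.
From mathcomp Require Import all_classical all_reals all_analysis.
From mathcomp Require Import (coercions, canonicals) mpoly.
From mathcomp Require Import measurable_realfun.
From mathcomp Require Import ring lra.
Set Implicit Arguments.
Unset Strict Implicit.
Unset Printing Implicit Defensive.
Import Order.TTheory GRing.Theory Num.Theory.
Import numFieldNormedType.Exports.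
Local Open Scope classical_set_scope.
Local Open Scope ring_scope.

(** Functions are not quotiented by almost-everywhere equality, so two candidates for a weak
    derivative are compared only through their inner products with L^2 functions; norms of errors
    are recovered from these pairings. The orthogonality of div (sigma - v) to div eps holds only
    once the representative chosen for div eps is known to agree almost everywhere with a polynomial
    of degree p on each simplex. This is what calls for test functions supported inside one simplex,
    an integration by parts for them, and negligible simplex boundaries. The cross term (div eps,
    delta) is harmless because the energy contains h^2 |div eps|^2, which absorbs the factor h of
    the Friedrichs inequality. Writing S for |sigma - v| + |grad (u - w)|, the energy yields |eps|
    <= 2 S and |grad delta| <= 3 S; the triangle inequality adds one more S, hence 6. No mollifier
    occurs: all smooth cutoffs are built from e^(-1/t) inside one algebra stable under partial
    derivatives. Since H^1_0 is a closure, Green and Friedrichs are limits of statements on test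
    functions. *)

Section rV_topology.
Context {R : realType} {n : nat}.
Implicit Types (U A : set 'rV[R]_n) (x y q : 'rV[R]_n).

(** * Open sets, cubes and the Borel structure of R^n *)

Lemma ball_rVP x (e : R) y : 0 < e ->
  ball x e y <-> forall i, `|x 0 i - y 0 i| < e.
Proof.
move=> e0; split=> [[_ h] i|h]; first exact: h.
by split=> // i j; rewrite ord1; exact: h.
Qed.

(** The sigma-algebra is generated by coordinates, so open sets become measurable through a
    countable family of cubes with rational centres. Indices without an admissible cube give the
    empty set. The closed cube is required to lie in [U] so that [ball_bump] can place a compact
    support there. *)
Lemma open_bigcup_ball U : open U ->
  exists2 F : (set 'rV[R]_n)^nat, U = \bigcup_k F k &
  forall k, F k = set0 \/ exists q (r : R), [/\ 0 < r, F k = ball q r &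
    [set y : 'rV[R]_n | forall i, `|q 0 i - y 0 i| <= r] `<=` U].
Proof.
move=> oU.
pose cube (c : 'rV[rat]_n * nat) := ball (map_mx ratr c.1 : 'rV[R]_n) c.2.+1%:R^-1.
pose inU (c : 'rV[rat]_n * nat) :=
  [set y : 'rV[R]_n | forall i, `|map_mx ratr c.1 0 i - y 0 i| <= c.2.+1%:R^-1] `<=` U.
exists (fun k => if unpickle k is Some c then
                   if `[< inU c >] then cube c else set0 else set0); last first.
  move=> k; case: (unpickle k) => [c|]; last by left.
  case: asboolP => [ic|_]; last by left.
  by right; exists (map_mx ratr c.1), c.2.+1%:R^-1; split.
apply/seteqP; split=> x; last first.
  move=> [k _]; case: (unpickle k) => [c|//].
  case: asboolP => // ic [_ h]; apply: ic => i; exact/ltW/h.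
move=> Ux; have /nbhs_ballP[e /= e0 eU] := open_nbhs_nbhs (conj oU Ux).
have e20 : 0 < e / 2 by rewrite divr_gt0.
(* A rational centre within 1/(m+1) < e/2 of [x] gives a closed cube of that radius that contains
   [x] and stays within distance e of it. *)
pose m := Num.trunc (e / 2)^-1.
have me : m.+1%:R^-1 < e / 2.
  by rewrite -[ltRHS]invrK ltf_pV2 ?posrE ?invr_gt0// truncnS_gt.
have m0 : 0 < m.+1%:R^-1 :> R by rewrite invr_gt0.
have qi (i : 'I_n) : exists q : rat, `|ratr q - x 0 i| < m.+1%:R^-1.
  move: m0; set z : R := _^-1 => m0.
  have [q] := @rat_in_itvoo R (x 0 i) (x 0 i + z) ltac:(by rewrite ltrDl).
  by rewrite in_itv/= => /andP[h1 h2]; exists q;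
    rewrite ltr_norml; apply/andP; split; lra.
have [q qP] := choice qi.
pose c := (\row_i q i : 'rV[rat]_n, m).
exists (pickle c) => //; rewrite pickleK asboolT//.
  by apply/ball_rVP => // i; rewrite !mxE.
move=> y /= h; apply: eU; apply/ball_rVP => // i.
have := h i; have := qP i; rewrite !mxE; move: me => /=.
rewrite !ltr_norml ler_norml; set z := _.+1%:R^-1.
move=> ? /andP[? ?] /andP[? ?]; apply/andP; split; lra.
Qed.

Lemma measurable_ball_rV q (r : R) : 0 < r -> measurable (ball q r).
Proof.
move=> r0.
rewrite (_ : ball q r = \big[setI/setT]_(i < n) [set x : 'rV[R]_n | `|q 0 i - x 0 i| < r]).
  apply: bigsetI_measurable => i _.
  rewrite (_ : mkset _ = (fun x => x 0 i) @^-1` ball (q 0 i) r); last by [].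
  by rewrite -[X in measurable X]setTI; apply: measurable_coord => //;
    by apply: open_measurable; exact: ball_open.
rewrite -bigcap_seq; apply/seteqP; split=> x.
  by move/ball_rVP => h i _; exact: h.
by move=> h; apply/ball_rVP => // i; apply: h; rewrite /= mem_index_enum.
Qed.

Lemma measurable_open_rV U : open U -> measurable U.
Proof.
move=> /open_bigcup_ball[F -> FP]; apply: bigcupT_measurable => k.
by case: (FP k) => [->//|[q [r [r0 -> _]]]]; exact: measurable_ball_rV.
Qed.

Lemma continuous_measurable_rV (f : 'rV[R]_n -> R) :
  continuous f -> measurable_fun setT f.
Proof.
move=> /continuousP cf.
apply: (measurability (@RGenOpens.G R)); first exact: RGenOpens.measurableE.
move=> _ [_ [a [b ->] <-]]; rewrite setTI; apply: measurable_open_rV.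
by apply: cf; exact: interval_open.
Qed.

End rV_topology.

Lemma measurable_cube (R : realType) (n : nat) (M : R) :
  measurable [set x : 'rV[R]_n | forall i, -M <= x 0 i <= M].
Proof.
rewrite (_ : mkset _ = \bigcap_(i in [set: 'I_n])
    (fun x : 'rV[R]_n => x 0 i) @^-1` `[-M, M]).
  apply: fin_bigcap_measurable => // i _.
  by rewrite -[X in measurable X]setTI; exact: measurable_coord.
apply/seteqP; split=> x /=; first by move=> h i _; rewrite /= in_itv/=.
by move=> h i; have := h i I; rewrite /= in_itv.
Qed.

Lemma lebesgue_rV_cube_lty (R : realType) (n : nat) (M : R) :
  (lebesgue_rV n [set x : 'rV[R]_n | forall i, (-M <= x 0 i <= M)%R] < +oo)%E.
Proof.
elim: n => [|n IHn].
  by rewrite [X in (X < _)%E]/= diracE ltry.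
set A := (X in lebesgue_rV _ X).
have AE : cons_rV (n := n) @^-1` A =
    `[-M, M] `*` [set x : 'rV[R]_n | forall i, -M <= x 0 i <= M].
  apply/seteqP; split=> -[t x] /= h; rewrite ?in_itv/=.
    split => [|i]; first by have := h ord0; rewrite mxE unlift_none.
    by have := h (lift ord0 i); rewrite mxE liftK.
  case: h => h1 h2 i; rewrite mxE; case: unliftP => [j|] _ /=; first exact: h2.
  by move: h1; rewrite in_itv.
rewrite [X in (X < _)%E](_ : _ =
  (@lebesgue_measure R \x lebesgue_rV n)%E (cons_rV (n := n) @^-1` A))//.
rewrite AE product_measure1E//; last exact: measurable_cube.
apply: lte_mul_pinfty => //.
suff : (lebesgue_measure `[-M, M]%classic : \bar R) \is a fin_num by [].
by rewrite lebesgue_measure_itv/=; case: ifP.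
Qed.

(** * The flat function e^(-1/w) and its derivatives *)

Section flat.
Context {R : realType}.
Implicit Types (w : R) (k : nat).

(** The case k = 0 is the classical smooth function vanishing on the negative half-line. The factors
    w^(-k) make the family stable under differentiation up to linear combinations. *)
Definition flat k w : R := if 0 < w then w^-1 ^+ k * expR (- w^-1) else 0.

Lemma flat_ge0 k w : 0 <= flat k w.
Proof.
by rewrite /flat; case: ifP => // w0; rewrite mulr_ge0 ?expR_ge0// exprn_ge0// invr_ge0 ltW.
Qed.

Lemma flat0_le1 w : flat 0 w <= 1.
Proof.
rewrite /flat; case: ifPn => // w0.
by rewrite expr0 mul1r -expR0 ler_expR oppr_le0 invr_ge0 ltW.
Qed.

Lemma flat_eq0 k w : (flat k w == 0) = (w <= 0).
Proof.
rewrite /flat; case: ltP => [w0|_]; last by rewrite eqxx.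
by rewrite mulf_eq0 expf_eq0 invr_eq0 gt_eqF// andbF/= gt_eqF// expR_gt0.
Qed.

(** Comes from e^t >= t^(k+1) / (k+1)! at t = 1/w. A bound linear in w, for every k, is what
    differentiability at the origin requires. *)
Lemma flat_le k w : `|flat k w| <= k.+1`!%:R * `|w|.
Proof.
rewrite ger0_norm ?flat_ge0// /flat; case: ifPn => w0; last by rewrite mulr_ge0.
have iw0 : 0 <= w^-1 by rewrite invr_ge0 ltW.
have h := expR_ge1Dxn k iw0.
have h2 : w^-1 ^+ k.+1 <= k.+1`!%:R * expR w^-1.
  rewrite -ler_pdivrMl ?ltr0n ?fact_gt0// mulrC.
  by apply: le_trans h; rewrite lerDr.
rewrite (ger0_norm (ltW w0)) expRN ler_pdivrMr ?expR_gt0// mulrAC.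
rewrite (_ : w^-1 ^+ k = w^-1 ^+ k.+1 * w); first by rewrite ler_pM2r.
by rewrite exprSr divfK// gt_eqF.
Qed.

Lemma is_derive_flat k w :
  is_derive w 1 (flat k) (flat k.+2 w - k%:R * flat k.+1 w).
Proof.
have [w0|w0|w0] := ltrgtP w 0.
- rewrite /flat ltNge (ltW w0)/= mulr0 subr0.
  apply: (near_eq_is_derive (f := cst 0)).
  near=> z; rewrite ltNge ifF//; apply/negbF; apply: ltW; near: z.
  exact: lt_nbhsl.
- have di : is_derive w 1 (fun z : R => z^-1) (- w ^- 2).
    have wn0 : w != 0 by rewrite gt_eqF.
    apply: DeriveDef; first by apply: derivableV => //; exact: derivable_id.
    by rewrite deriveV// derive_id [LHS]mulr1.
  have de : is_derive w 1 (expR \o (fun z : R => - z^-1)) (expR (- w^-1) * - (- w ^- 2)).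
    by apply: is_derive1_comp; exact: is_deriveN.
  apply: (near_eq_is_derive (f := (fun z : R => z^-1) ^+ k *
      (expR \o (fun z : R => - z^-1)))).
    near=> z; rewrite /flat ifT; last by near: z; exact: lt_nbhsr.
    by rewrite [LHS]/(_ * _)/= exprfctE.
  apply: is_derive_eq; rewrite /flat w0 exprfctE/=.
  rewrite /GRing.scale/=.
  case: k => [|k]; rewrite ?exprS ?expr0; field; rewrite ?gt_eqF//.
- suff cv : (fun h => h^-1 *: ((flat k \o shift w) (h *: 1) - flat k w)) @ 0^' --> (0 : R).
    have -> : flat k.+2 w - k%:R * flat k.+1 w = 0 by rewrite w0 /flat ltxx mulr0 subr0.
    by apply: DeriveDef; [apply/cvg_ex; exists 0 | exact: cvg_lim cv].
  rewrite w0 {w w0}.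
  apply/cvgr0Pnorm_lt => e e0; near=> h.
  (* At the origin, dividing by [h] merely raises the index, and [flat_le] makes the quotient tend
     to 0. *)
  rewrite (_ : _ *: _ = flat k.+1 h).
    apply: le_lt_trans (flat_le _ _) _.
    rewrite mulrC -ltr_pdivlMr ?ltr0n ?fact_gt0//.
    by near: h; apply: dnbhs0_lt; rewrite divr_gt0// ltr0n fact_gt0.
  rewrite /= addr0 /GRing.scale/= mulr1 /flat ltxx subr0.
  case: ifP => _; last by rewrite mulr0.
  by rewrite exprS -mulrA.
Unshelve. all: by end_near. Qed.

Lemma continuous_flat k : continuous (flat k).
Proof.
move=> w; apply/differentiable_continuous/derivable1_diffP.
by have [] := is_derive_flat k w.
Qed.

Lemma cvg_flat0 w : 0 < w -> flat 0 (n.+1%:R * w) @[n --> \oo] --> (1 : R).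
Proof.
move=> w0; rewrite (_ : (fun n => _) = expR \o (fun n => - (harmonic n * w^-1))).
  rewrite -[X in _ --> X](expR0 R) -[X in expR X]oppr0 -[X in - X](mul0r w^-1).
  apply: continuous_cvg; first exact: continuous_expR.
  by apply: cvgN; apply: cvgMl; exact: cvg_harmonic.
by apply/funext => n; rewrite /flat mulr_gt0// expr0 mul1r /= invfM.
Qed.

End flat.

(** * Stability properties of smooth functions *)

Section smooth.
Context {R : realType} {d : nat}.
Implicit Types (f g phi : 'rV[R]_d -> R) (i : 'I_d).

(** Only a directional derivative of [f] is assumed, so the one-variable chain rule is applied along
    the line t -> t v + x. *)
Lemma is_derive_comp_rV (h : R -> R) f (x v : 'rV[R]_d) (a b : R) :
  is_derive (f x) 1 h a -> is_derive x v f b -> is_derive x v (h \o f) (a * b).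
Proof.
have E g : 'D_v g x = 'D_1 (fun t : R => g (t *: v + x)) 0.
  rewrite /derive; set g1 := fun h => h^-1 *: _; set g2 := fun h => h^-1 *: _.
  suff -> : g1 = g2 by [].
  by rewrite funeqE /g1 /g2 => t /=; rewrite addr0 scale0r add0r [_%:A]mulr1.
move=> dh [/derivable1P df]; rewrite E => <-.
have dh' : is_derive (f ((0 : R) *: v + x)) 1 h a by rewrite scale0r add0r.
have [d1 d2] := is_derive1_comp dh' (DeriveDef df erefl).
by apply: DeriveDef; [apply/derivable1P | rewrite E].
Qed.

(** A coinduction principle: to prove smoothness it suffices to exhibit a class of continuous
    functions stable under partial derivatives, with no induction on strings of derivatives. *)
Lemma smooth_subset (C : set ('rV[R]_d -> R)) :
  (forall f, C f -> continuous f) ->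
  (forall f i, C f -> exists2 g, C g &
     forall x, is_derive x (delta_mx 0 i) f (g x)) ->
  C `<=` smooth.
Proof.
move=> cC dC f Cf.
have Cs s : C (iter_pderiv s f).
  elim: s => //= i s IHs; have [g Cg gP] := dC _ i IHs.
  rewrite (_ : pderiv i _ = g)//; apply/funext => x.
  by rewrite /pderiv; have [] := gP x.
move=> s; split; first exact: cC.
by move=> i x; have [g _ gP] := dC _ i (Cs s); have [] := gP x.
Qed.

Lemma smooth_continuous f : smooth f -> continuous f.
Proof. by move=> /(_ [::])[]. Qed.

Lemma smooth_is_derive f i x : smooth f -> is_derive x (delta_mx 0 i) f (pderiv i f x).
Proof. by move=> /(_ [::])[_ h]; apply: DeriveDef => //; exact: h. Qed.

Lemma smooth_pderiv f i : smooth f -> smooth (pderiv i f).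
Proof.
move=> sf s; rewrite (_ : iter_pderiv s (pderiv i f) = iter_pderiv (rcons s i) f)//.
by rewrite /iter_pderiv -cats1 foldr_cat.
Qed.

(** The least class to which [smooth_subset] applies: the Leibniz rule needs sums and products, and
    the derivative of [flat k] needs the indices k+1 and k+2, hence all [k] at once. *)
Inductive smooth_alg : set ('rV[R]_d -> R) :=
| SA_smooth f : smooth f -> smooth_alg f
| SA_add f g : smooth_alg f -> smooth_alg g -> smooth_alg (f + g)
| SA_mul f g : smooth_alg f -> smooth_alg g -> smooth_alg (f * g)
| SA_flat k f : smooth_alg f -> smooth_alg (flat k \o f).

Lemma smooth_cst (c : R) : smooth (cst c : 'rV[R]_d -> R).
Proof.
apply: (@smooth_subset [set f | exists c, f = cst c]); last by exists c.
  by move=> _ [e ->]; exact: cst_continuous.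
by move=> _ i [e ->]; exists (cst 0); [exists 0 | move=> x; exact: is_derive_cst].
Qed.

Lemma is_derive_coord i j (x : 'rV[R]_d) :
  is_derive x (delta_mx 0 i) (fun y => y 0 j) (i == j)%:R.
Proof.
have cv : (fun h : R => h^-1 *: (((fun y : 'rV[R]_d => y 0 j) \o shift x) (h *: delta_mx 0 i)
    - x 0 j)) @ 0^' --> ((i == j)%:R : R).
  have : cst (i == j)%:R @ (0 : R)^' --> ((i == j)%:R : R) by exact: cvg_cst.
  apply: cvg_trans; apply: near_eq_cvg; near=> h.
  rewrite /= !mxE eqxx/= addrK eq_sym /GRing.scale/= mulrA mulVf ?mul1r//.
  by near: h; exact: nbhs_dnbhs_neq.
by apply: DeriveDef; [apply/cvg_ex; eexists; exact: cv | exact: cvg_lim cv].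
Unshelve. all: by end_near. Qed.

Lemma smooth_coord j : smooth (fun x : 'rV[R]_d => x 0 j).
Proof.
apply: (@smooth_subset [set f | f = (fun x : 'rV[R]_d => x 0 j) \/ exists c, f = cst c]).
- move=> f [->|[c ->]]; [exact: coord_continuous | exact: cst_continuous].
- move=> f i [->|[c ->]].
    exists (cst (i == j)%:R); [by right; eexists | by move=> x; exact: is_derive_coord].
  by exists (cst 0); [right; exists 0 | move=> x; exact: is_derive_cst].
- by left.
Qed.

Lemma smooth_alg_smooth : smooth_alg `<=` smooth.
Proof.
apply: smooth_subset => [f|f i].
  elim=> {f} [f /smooth_continuous//|f g _ cf _ cg|f g _ cf _ cg|k f _ cf] x.
  - exact: cvgD (cf x) (cg x).
  - exact: cvgM (cf x) (cg x).
  - by apply: continuous_comp; [exact: cf | exact: continuous_flat].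
elim=> {f} [f sf|f g _ [f' cf df] _ [g' cg dg]|
  f g af [f' cf df] ag [g' cg dg]|k f af [f' cf df]].
- exists (pderiv i f); first exact/SA_smooth/smooth_pderiv.
  by move=> x; exact: smooth_is_derive.
- by exists (f' + g'); [exact: SA_add|move=> x; exact: is_deriveD].
- exists (f * g' + g * f'); first by apply: SA_add; apply: SA_mul.
  by move=> x; exact: is_deriveM.
- exists ((flat k.+2 \o f + cst (- k%:R) * (flat k.+1 \o f)) * f').
    apply: SA_mul => //; apply: SA_add; first exact: SA_flat.
    by apply: SA_mul; [exact/SA_smooth/smooth_cst | exact: SA_flat].
  move=> x; have := is_derive_comp_rV (is_derive_flat k (f x)) (df x).
  by rewrite -mulNr.
Qed.

Lemma smoothD f g : smooth f -> smooth g -> smooth (f + g).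
Proof. by move=> sf sg; apply/smooth_alg_smooth/SA_add; exact: SA_smooth. Qed.

Lemma smoothM f g : smooth f -> smooth g -> smooth (f * g).
Proof. by move=> sf sg; apply/smooth_alg_smooth/SA_mul; exact: SA_smooth. Qed.

Lemma smooth_flat k f : smooth f -> smooth (flat k \o f).
Proof. by move=> sf; apply/smooth_alg_smooth/SA_flat; exact: SA_smooth. Qed.

Lemma smoothB f g : smooth f -> smooth g -> smooth (f - g).
Proof.
move=> sf sg; rewrite (_ : f - g = f + cst (-1) * g).
  by apply: smoothD => //; apply: smoothM => //; exact: smooth_cst.
by apply/funext => x; rewrite -[LHS]/(f x - g x) -[RHS]/(f x + -1 * g x) mulN1r.
Qed.

Lemma pderivB i f g : smooth f -> smooth g ->
  pderiv i (f - g) = pderiv i f - pderiv i g.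
Proof.
move=> /smooth_is_derive sf /smooth_is_derive sg; apply/funext => x.
by have [] := is_deriveB (sf i x) (sg i x).
Qed.

Lemma pderivM i f g : smooth f -> smooth g ->
  pderiv i (f * g) = f * pderiv i g + g * pderiv i f.
Proof.
move=> /smooth_is_derive sf /smooth_is_derive sg; apply/funext => x.
by have [] := is_deriveM (sf i x) (sg i x).
Qed.

End smooth.

(** * Cauchy-Schwarz and Minkowski for a semidefinite form *)

Section prehilbert.
Context {R : realType} {V : Type} (D : V -> Prop) (comb : R -> V -> V -> V)
  (B : V -> V -> R).
Hypothesis comb_dom : forall a x y, D x -> D y -> D (comb a x y).
Hypothesis combB : forall a x y z, D x -> D y -> D z ->
  B (comb a x y) z = a * B x z + B y z.
Hypothesis BC : forall x y, B x y = B y x.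
(** The form is bilinear only on the domain [D], as integrals of products need square integrability;
    [comb a x y] stands for a x + y. The scalar and the vector L^2 products are both instances. *)
Hypothesis B_ge0 : forall x, 0 <= B x x.

Lemma form_comb2 a x y : D x -> D y ->
  B (comb a x y) (comb a x y) = a ^+ 2 * B x x + 2 * a * B x y + B y y.
Proof.
move=> Dx Dy; rewrite combB//; last exact: comb_dom.
by rewrite (BC x (comb _ _ _)) (BC y (comb _ _ _)) !combB// (BC y x); ring.
Qed.

Lemma form_CauchySchwarz x y : D x -> D y ->
  `|B x y| <= Num.sqrt (B x x) * Num.sqrt (B y y).
Proof.
move=> Dx Dy; rewrite -sqrtrM// -sqrtr_sqr; apply: ler_wsqrtr.
have h a : 0 <= a ^+ 2 * B x x + 2 * a * B x y + B y y.
  by rewrite -form_comb2.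
have [x0|x0] := eqVneq (B x x) 0.
  have [y0|y0] := eqVneq (B x y) 0; first by rewrite y0 expr0n mulr_ge0.
  (* With B x x = 0 the quadratic is affine in [a]; this choice gives it the value -1, a
     contradiction. *)
  have := h (- (B y y + 1) / (2 * B x y)).
  rewrite x0 mulr0 add0r (_ : 2 * _ * _ = - (B y y + 1)); last by field.
  lra.
have xp : 0 < B x x by rewrite lt_neqAle eq_sym x0 B_ge0.
(* The minimiser of the quadratic. *)
have := h (- B x y / B x x); rewrite -(ler_pM2l xp) mulr0.
rewrite (_ : B x x * _ = B x x * B y y - B x y ^+ 2); last by field.
by rewrite subr_ge0.
Qed.

Lemma form_Minkowski x y : D x -> D y ->
  Num.sqrt (B (comb 1 x y) (comb 1 x y)) <= Num.sqrt (B x x) + Num.sqrt (B y y).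
Proof.
move=> Dx Dy; rewrite -(ler_pXn2r (n := 2)) ?nnegrE ?addr_ge0 ?sqrtr_ge0//.
rewrite sqr_sqrtr// form_comb2// sqrrD !sqr_sqrtr//.
by have := ler_norm (B x y); have := form_CauchySchwarz Dx Dy; lra.
Qed.

End prehilbert.

Lemma normM_le_sqrD (R : realType) (a b : R) : `|a * b| <= a ^+ 2 + b ^+ 2.
Proof.
by rewrite ler_norml; apply/andP; split;
  have := sqr_ge0 (a - b); have := sqr_ge0 (a + b); nra.
Qed.

(** * The spaces L^2 of scalar and vector functions *)

Section L2.
Context {R : realType} {d : nat} (Omega : set 'rV[R]_d).
Hypothesis mO : measurable Omega.
Implicit Types (f g h : 'rV[R]_d -> R) (v w z : 'rV[R]_d -> 'rV[R]_d).
Let mu := lebesgue_rV (R := R) d.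

Lemma L2_integrableM f g : L2 Omega f -> L2 Omega g ->
  mu.-integrable Omega (fun x => (f x * g x)%:E).
Proof.
move=> [mf if2] [mg ig2].
apply: (le_integrable mO (g := (fun x => (f x ^+ 2)%:E) \+ (fun x => (g x ^+ 2)%:E))%E).
- by apply/measurable_EFinP; exact: measurable_funM.
- by move=> x _ /=; rewrite lee_fin [leRHS]ger0_norm ?normM_le_sqrD ?addr_ge0 ?sqr_ge0.
- exact: integrableD.
Qed.

Lemma L2_comb a f g : L2 Omega f -> L2 Omega g -> L2 Omega (fun x => a * f x + g x).
Proof.
move=> Lf Lg; have [mf if2] := Lf; have [mg ig2] := Lg; split.
  by apply: measurable_funD => //; apply: measurable_funM => //; exact: measurable_cst.
rewrite (_ : (fun x => _) = ((fun x => (a ^+ 2)%:E * (f x ^+ 2)%:E) \+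
    ((fun x => (2 * a)%:E * (f x * g x)%:E) \+ (fun x => (g x ^+ 2)%:E)))%E).
  apply: integrableD => //; first exact: integrableZl.
  by apply: integrableD => //; apply: integrableZl => //; exact: L2_integrableM.
by apply/funext => x; rewrite /= -!EFinM -!EFinD; congr (_%:E); ring.
Qed.

Lemma innerC f g : inner Omega f g = inner Omega g f.
Proof. by apply: eq_Rintegral => x _; rewrite mulrC. Qed.

Lemma inner_combl a f g h : L2 Omega f -> L2 Omega g -> L2 Omega h ->
  inner Omega (fun x => a * f x + g x) h = a * inner Omega f h + inner Omega g h.
Proof.
move=> Lf Lg Lh; rewrite /inner -RintegralZl//; last exact: L2_integrableM.
rewrite -RintegralD//.
- by apply: eq_Rintegral => x _; ring.
- exact: (integrableZl mO a (L2_integrableM Lf Lh)).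
- exact: L2_integrableM.
Qed.

Lemma inner_ge0 f : 0 <= inner Omega f f.
Proof. by apply: Rintegral_ge0 => x _; rewrite -expr2 sqr_ge0. Qed.

Lemma inner_CauchySchwarz f g : L2 Omega f -> L2 Omega g ->
  `|inner Omega f g| <= norm2 Omega f * norm2 Omega g.
Proof.
exact: (form_CauchySchwarz L2_comb inner_combl innerC inner_ge0).
Qed.

Lemma L2_integrable_dot v w : L2v Omega v -> L2v Omega w ->
  mu.-integrable Omega (fun x => (dot (v x) (w x))%:E).
Proof.
move=> Lv Lw.
rewrite (_ : (fun x => _) = (fun x => \sum_i (v x 0 i * w x 0 i)%:E)%E).
  by apply: integrable_sum => // i _; exact: L2_integrableM.
by apply/funext => x; rewrite sumEFin.
Qed.

Lemma innervE v w : L2v Omega v -> L2v Omega w ->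
  innerv Omega v w = \sum_i inner Omega (fun x => v x 0 i) (fun x => w x 0 i).
Proof.
move=> Lv Lw; rewrite /innerv /Rintegral.
under eq_integral do rewrite -sumEFin.
rewrite integral_sum//; last by move=> i; exact: L2_integrableM.
rewrite sum_fine// => i _.
by apply: integrable_fin_num => //; exact: L2_integrableM.
Qed.

Lemma L2v_comb a v w : L2v Omega v -> L2v Omega w -> L2v Omega (fun x => a *: v x + w x).
Proof.
move=> Lv Lw i; rewrite (_ : (fun x => _) = (fun x => a * v x 0 i + w x 0 i)).
  exact: L2_comb.
by apply/funext => x; rewrite !mxE.
Qed.

Lemma innervC v w : innerv Omega v w = innerv Omega w v.
Proof.
by apply: eq_Rintegral => x _; apply: eq_bigr => i _; rewrite mulrC.
Qed.

Lemma innerv_combl a v w z : L2v Omega v -> L2v Omega w -> L2v Omega z ->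
  innerv Omega (fun x => a *: v x + w x) z = a * innerv Omega v z + innerv Omega w z.
Proof.
move=> Lv Lw Lz; rewrite /innerv -RintegralZl//; last exact: L2_integrable_dot.
rewrite -RintegralD//.
- apply: eq_Rintegral => x _; rewrite /dot mulr_sumr -big_split/=.
  by apply: eq_bigr => i _; rewrite !mxE; ring.
- exact: (integrableZl mO a (L2_integrable_dot Lv Lz)).
- exact: L2_integrable_dot.
Qed.

Lemma innerv_ge0 v : 0 <= innerv Omega v v.
Proof.
by apply: Rintegral_ge0 => x _; apply: sumr_ge0 => i _; rewrite -expr2 sqr_ge0.
Qed.

Lemma innerv_CauchySchwarz v w : L2v Omega v -> L2v Omega w ->
  `|innerv Omega v w| <= norm2v Omega v * norm2v Omega w.
Proof.
exact: (form_CauchySchwarz L2v_comb innerv_combl innervC innerv_ge0).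
Qed.

Lemma norm2v_ge0 v : 0 <= norm2v Omega v. Proof. exact: sqrtr_ge0. Qed.
Lemma norm2_ge0 f : 0 <= norm2 Omega f. Proof. exact: sqrtr_ge0. Qed.

Lemma sqr_norm2 f : norm2 Omega f ^+ 2 = inner Omega f f.
Proof. by rewrite sqr_sqrtr// inner_ge0. Qed.

Lemma sqr_norm2v v : norm2v Omega v ^+ 2 = innerv Omega v v.
Proof. by rewrite sqr_sqrtr// innerv_ge0. Qed.

Lemma L2_0 : L2 Omega (fun=> 0).
Proof.
split; first exact: measurable_cst.
rewrite (_ : (fun x => _) = cst 0%E); first exact: integrable0.
by apply/funext => x; rewrite expr0n.
Qed.

Lemma L2B f g : L2 Omega f -> L2 Omega g -> L2 Omega (fun x => f x - g x).
Proof.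
move=> Lf Lg; rewrite (_ : (fun x => _) = (fun x => -1 * g x + f x)).
  exact: L2_comb.
by apply/funext => x; ring.
Qed.

Lemma innerBl f g h : L2 Omega f -> L2 Omega g -> L2 Omega h ->
  inner Omega (fun x => f x - g x) h = inner Omega f h - inner Omega g h.
Proof.
move=> Lf Lg Lh; rewrite -mulN1r addrC -inner_combl//.
by apply: eq_Rintegral => x _; ring.
Qed.

Lemma L2vB v w : L2v Omega v -> L2v Omega w -> L2v Omega (fun x => v x - w x).
Proof.
move=> Lv Lw i; rewrite (_ : (fun x => _) = (fun x => v x 0 i - w x 0 i)); first exact: L2B.
by apply/funext => x; rewrite !mxE.
Qed.

Lemma innervBl v w z : L2v Omega v -> L2v Omega w -> L2v Omega z ->
  innerv Omega (fun x => v x - w x) z = innerv Omega v z - innerv Omega w z.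
Proof.
move=> Lv Lw Lz; rewrite -mulN1r addrC -innerv_combl//.
by apply: eq_Rintegral => x _; rewrite scaleN1r addrC.
Qed.

Lemma L2vD v w : L2v Omega v -> L2v Omega w -> L2v Omega (fun x => v x + w x).
Proof.
move=> Lv Lw; rewrite (_ : (fun x => _) = (fun x => 1 *: v x + w x)); first exact: L2v_comb.
by apply/funext => x; rewrite scale1r.
Qed.

Lemma innervDl v w z : L2v Omega v -> L2v Omega w -> L2v Omega z ->
  innerv Omega (fun x => v x + w x) z = innerv Omega v z + innerv Omega w z.
Proof.
move=> Lv Lw Lz; rewrite -[X in X + _]mul1r -innerv_combl//.
by apply: eq_Rintegral => x _; rewrite scale1r.
Qed.

Lemma norm2v_triangle v w : L2v Omega v -> L2v Omega w ->
  norm2v Omega (fun x => v x + w x) <= norm2v Omega v + norm2v Omega w.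
Proof.
move=> Lv Lw; rewrite (_ : (fun x => v x + w x) = (fun x => 1 *: v x + w x)).
  exact: (form_Minkowski L2v_comb innerv_combl innervC innerv_ge0).
by apply/funext => x; rewrite scale1r.
Qed.

Lemma norm2vN v : norm2v Omega (fun x => - v x) = norm2v Omega v.
Proof.
congr Num.sqrt; apply: eq_Rintegral => x _.
by apply: eq_bigr => i _; rewrite !mxE mulrNN.
Qed.

Lemma norm2v_triangleB v w : L2v Omega v -> L2v Omega w ->
  norm2v Omega (fun x => v x - w x) <= norm2v Omega v + norm2v Omega w.
Proof.
move=> Lv Lw; rewrite -(norm2vN w); apply: norm2v_triangle => //.
move=> i; rewrite (_ : (fun x => _) = (fun x => 0 - w x 0 i)).
  by apply: L2B => //; exact: L2_0.
by apply/funext => x; rewrite !mxE sub0r.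
Qed.

Lemma norm2_coord_le v i : L2v Omega v ->
  norm2 Omega (fun x => v x 0 i) <= norm2v Omega v.
Proof.
move=> Lv; apply: ler_wsqrtr; rewrite innervE// (bigD1 i)//= lerDl.
by apply: sumr_ge0 => j _; exact: inner_ge0.
Qed.

Lemma eq_inner_ae f g h : L2 Omega f -> L2 Omega g -> L2 Omega h ->
  {ae mu, forall x, Omega x -> f x = g x} -> inner Omega f h = inner Omega g h.
Proof.
move=> [mf _] [mg _] [mh _] fg; congr fine; apply: ae_eq_integral => //.
- by apply/measurable_EFinP; exact: measurable_funM.
- by apply/measurable_EFinP; exact: measurable_funM.
- by apply: filterS fg => x fg Ox; rewrite fg.
Qed.

Lemma bounded_L2 f (M : R) : (mu Omega < +oo)%E -> measurable_fun Omega f ->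
  (forall x, Omega x -> `|f x| <= M) -> L2 Omega f.
Proof.
move=> Ofin mf fM; split=> //.
apply: (@le_integrable _ _ _ _ _ mO _ (fun=> (M ^+ 2)%:E)).
- by apply/measurable_EFinP; exact: measurable_funX.
- move=> x Ox; rewrite lee_fin !(ger0_norm (sqr_ge0 _)).
  rewrite -(real_normK (num_real (f x))) ler_pXn2r ?nnegrE ?fM//.
  exact: le_trans (fM x Ox).
- apply/integrableP; split; first exact: measurable_cst.
  by rewrite integral_cst//= lte_mul_pinfty// ?lee_fin.
Qed.

Lemma L2M_bounded f g (M : R) : L2 Omega f -> measurable_fun Omega g ->
  (forall x, Omega x -> `|g x| <= M) -> L2 Omega (fun x => g x * f x).
Proof.
move=> [mf if2] mg gM; split; first exact: measurable_funM.
apply: (le_integrable mO (g := fun x => ((M ^+ 2)%:E * (f x ^+ 2)%:E)%E)).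
- by apply/measurable_EFinP; apply: measurable_funX; exact: measurable_funM.
- move=> x Ox; rewrite lee_fin [leRHS]ger0_norm; last by rewrite mulr_ge0 ?sqr_ge0.
  rewrite (ger0_norm (sqr_ge0 _)) exprMn ler_wpM2r ?sqr_ge0//.
  rewrite -(real_normK (num_real (g x))) ler_pXn2r ?nnegrE ?gM//.
  exact: le_trans (gM x Ox).
- exact: (integrableZl mO (M ^+ 2) if2).
Qed.

End L2.

(** * Test functions: stability, boundedness, existence *)

Section test_functions.
Context {R : realType} {d : nat}.
Implicit Types (f g phi psi : 'rV[R]_d -> R) (U : set 'rV[R]_d).

(** The inclusion is into the closure because a derivative may be nonzero at points where [phi]
    itself vanishes, though never off its closed support. *)
Lemma test_function_support U phi psi : test_function U phi -> smooth psi ->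
  [set x | psi x != 0] `<=` closure [set x | phi x != 0] -> test_function U psi.
Proof.
move=> [_ cphi sphi] spsi sub.
have csub : closure [set x | psi x != 0] `<=` closure [set x | phi x != 0].
  rewrite [X in _ `<=` X](closure_id _).1; last exact: closed_closure.
  exact: closure_subset.
split=> //; last exact: subset_trans sphi.
by apply: (subclosed_compact _ cphi csub); exact: closed_closure.
Qed.

Lemma test_functionM U phi f : test_function U phi -> smooth f ->
  test_function U (f * phi).
Proof.
move=> tphi sf; have [sphi _ _] := tphi.
apply: test_function_support tphi _ _; first exact: smoothM.
apply: subset_trans (@subset_closure _ _) => x /=.
by rewrite -[(_ * _) x]/(f x * phi x) mulf_eq0 negb_or => /andP[].
Qed.

Lemma closure_support_pderiv i phi :
  [set x | pderiv i phi x != 0] `<=` closure [set x | phi x != 0].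
Proof.
move=> x; apply: contraPP => ncl; apply/negP; rewrite negbK; apply/eqP.
have : nbhs x (~` closure [set y | phi y != 0]).
  apply: open_nbhs_nbhs; split => //.
  by rewrite openC; exact: closed_closure.
move=> nx; rewrite /pderiv (near_eq_derive (g := cst 0)) ?derive_cst//.
apply: filterS nx => y; apply: contra_notP => /eqP yn0; exact: subset_closure.
Qed.

Lemma test_function_pderiv U phi i : test_function U phi ->
  test_function U (pderiv i phi).
Proof.
move=> tphi; have [sphi _ _] := tphi.
apply: test_function_support tphi (smooth_pderiv _ sphi) _.
exact: closure_support_pderiv.
Qed.

Lemma test_functionB U phi psi : test_function U phi -> test_function U psi ->
  test_function U (phi - psi).
Proof.
move=> [sphi cphi subphi] [spsi cpsi subpsi].
have sub : closure [set x | (phi - psi) x != 0] `<=`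
    closure [set x | phi x != 0] `|` closure [set x | psi x != 0].
  rewrite -closureU; apply: closure_subset => x /=.
  rewrite -[(_ - _) x]/(phi x - psi x).
  by have [->|] := eqVneq (phi x) 0; [rewrite sub0r oppr_eq0; right|left].
split; first exact: smoothB.
- by apply: (subclosed_compact _ _ sub); [exact: closed_closure|exact: compactU].
- by apply: subset_trans sub _ => x [/subphi|/subpsi].
Qed.

Lemma test_function_out U phi x : test_function U phi -> ~ U x -> phi x = 0.
Proof.
move=> [_ _ sub] nUx; apply/eqP; apply: contra_notT nUx => phix.
by apply: sub; exact: subset_closure.
Qed.

Lemma test_function_sub U U' phi : U `<=` U' -> test_function U phi ->
  test_function U' phi.
Proof. by move=> sub [? ? h]; split=> //; exact: subset_trans sub. Qed.

Lemma compact_support_bounded phi : continuous phi ->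
  compact (closure [set x | phi x != 0]) -> exists M, forall x, `|phi x| <= M.
Proof.
move=> cphi cpt.
have /compact_bounded[M [_ MP]] : compact (phi @` closure [set x | phi x != 0]).
  by apply: continuous_compact => //; exact: continuous_subspaceT.
exists (`|M| + 1) => x; have [->|phix] := eqVneq (phi x) 0.
  by rewrite normr0 addr_ge0.
apply: (MP (`|M| + 1)); first by rewrite ltr_pwDr// ler_norm.
by exists x => //; exact: subset_closure.
Qed.

Lemma test_function_bounded U phi : test_function U phi ->
  exists M, forall x, `|phi x| <= M.
Proof.
by move=> [/smooth_continuous cphi cpt _]; exact: compact_support_bounded.
Qed.

Lemma bounded_rV_cube U : bounded_set U ->
  exists M : R, forall x, U x -> forall i, -M <= x 0 i <= M.
Proof.
move=> [M [_ MP]]; exists (`|M| + 1) => x Ux i; rewrite -ler_norml.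
have /MP/(_ _ Ux) : M < `|M| + 1 by rewrite ltr_pwDr// ler_norm.
apply: le_trans; rewrite [leRHS]/Num.norm/= mx_normrE.
by apply/bigmax_geP; right => /=; exists (0, i).
Qed.

Lemma bounded_rV_lty U : measurable U -> bounded_set U ->
  (lebesgue_rV d U < +oo)%E.
Proof.
move=> mU /bounded_rV_cube[M MP].
apply: le_lt_trans (lebesgue_rV_cube_lty d M).
by apply: le_measure; rewrite ?inE//; exact: measurable_cube.
Qed.

Lemma test_function_L2 U phi : measurable U -> bounded_set U ->
  test_function U phi -> L2 U phi.
Proof.
move=> mU bU tphi; have [M MP] := test_function_bounded tphi.
apply: (bounded_L2 mU (M := M)) => //; first exact: bounded_rV_lty.
apply: measurable_funTS; apply: continuous_measurable_rV.
by case: tphi => /smooth_continuous.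
Qed.

Lemma test_function_L2_grad U phi : measurable U -> bounded_set U ->
  test_function U phi -> L2v U (grad phi).
Proof.
move=> mU bU tphi i; rewrite (_ : (fun x => _) = pderiv i phi).
  by apply: test_function_L2 => //; exact: test_function_pderiv.
by apply/funext => x; rewrite mxE.
Qed.

Lemma smooth_prod (I : Type) (s : seq I) (f : I -> 'rV[R]_d -> R) :
  (forall i, smooth (f i)) -> smooth (fun x => \prod_(i <- s) f i x).
Proof.
move=> sf; elim: s => [|i s IHs].
  rewrite (_ : (fun x => _) = cst 1); first exact: smooth_cst.
  by apply/funext => x; rewrite big_nil.
rewrite (_ : (fun x => _) = f i * (fun x => \prod_(i <- s) f i x)).
  exact: smoothM.
by apply/funext => x; rewrite big_cons.
Qed.

Lemma closed_cube (q : 'rV[R]_d) (r : R) :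
  closed [set y : 'rV[R]_d | forall i, `|q 0 i - y 0 i| <= r].
Proof.
rewrite (_ : mkset _ = \bigcap_(i in [set: 'I_d])
    (fun x : 'rV[R]_d => x 0 i) @^-1` `[q 0 i - r, q 0 i + r]).
  apply: closed_bigI => i _; apply: closed_comp; last exact: interval_closed.
  by move=> x _; exact: coord_continuous.
apply/seteqP; split=> x /= h i.
  move=> _; rewrite /= in_itv/=; have := h i.
  by rewrite ler_norml => /andP[? ?]; apply/andP; split; lra.
have := h i I; rewrite /= in_itv/= => /andP[? ?].
by rewrite ler_norml; apply/andP; split; lra.
Qed.

Lemma compact_cube (q : 'rV[R]_d) (r : R) :
  compact [set y : 'rV[R]_d | forall i, `|q 0 i - y 0 i| <= r].
Proof.
have h := @rV_compact R d (fun i => `[q 0 i - r, q 0 i + r]%classic)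
  (fun i => @segment_compact _ _ _).
apply: subclosed_compact (@closed_cube q r) h _ => x Qx i; rewrite /= in_itv/=; have := Qx i.
by rewrite ler_norml => /andP[? ?]; apply/andP; split; lra.
Qed.

Lemma ball_bump U (q : 'rV[R]_d) (r : R) : 0 < r ->
  [set y : 'rV[R]_d | forall i, `|q 0 i - y 0 i| <= r] `<=` U ->
  exists2 phi, test_function U phi & forall x, ball q r x -> phi x != 0.
Proof.
move=> r0 sub.
(* This is r^2 - (q_i - x_i)^2, positive exactly when |q_i - x_i| < r. It is spelled with sums and
   products so that its smoothness is convertible to that of the algebraic expression below. *)
pose w i (x : 'rV[R]_d) := r ^+ 2 + -1 * ((q 0 i + -1 * x 0 i) * (q 0 i + -1 * x 0 i)).
have sw i : smooth (w i).
  have sm : smooth (cst (q 0 i) + cst (-1) * (fun x : 'rV[R]_d => x 0 i)).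
    apply: smoothD; first exact: smooth_cst.
    by apply: smoothM; [exact: smooth_cst|exact: smooth_coord].
  have : smooth (cst (r ^+ 2) + cst (-1) *
    ((cst (q 0 i) + cst (-1) * (fun x : 'rV[R]_d => x 0 i)) *
    (cst (q 0 i) + cst (-1) * (fun x : 'rV[R]_d => x 0 i)))).
    apply: smoothD; first exact: smooth_cst.
    by apply: smoothM; [exact: smooth_cst|exact: smoothM].
  by [].
have wE i x : (flat 0 (w i x) != 0) = (`|q 0 i - x 0 i| < r).
  rewrite flat_eq0 -ltNge -[RHS](@ltr_pXn2r _ 2) ?nnegrE ?(ltW r0)//.
  rewrite real_normK ?num_real// -subr_gt0; congr (0 < _).
  by rewrite /w; ring.
pose phi (x : 'rV[R]_d) := \prod_(i < d) flat 0 (w i x).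
have phiE x : phi x != 0 <-> ball q r x.
  rewrite ball_rVP//; split=> [/prodf_neq0 h i|h].
    by rewrite -wE; exact: h.
  by apply/prodf_neq0 => i _; rewrite wE.
exists phi; last by move=> x /phiE.
pose Q := [set y : 'rV[R]_d | forall i, `|q 0 i - y 0 i| <= r].
have clQ : closed Q := @closed_cube q r.
have cpt : compact Q := @compact_cube q r.
have clsub : closure [set x | phi x != 0] `<=` Q.
  rewrite [X in _ `<=` X](closure_id _).1//; apply: closure_subset => x /phiE.
  by move/ball_rVP => /(_ r0) h i; exact/ltW/h.
split; last exact: subset_trans sub.
- by apply: smooth_prod => i; exact: smooth_flat.
- by apply: (subclosed_compact _ cpt clsub); exact: closed_closure.
Qed.

End test_functions.

(** * The fundamental lemma of the calculus of variations *)

Section fundamental_lemma.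
Context {R : realType} {d : nat}.
Implicit Types (f g phi psi : 'rV[R]_d -> R) (U : set 'rV[R]_d).
Let mu := lebesgue_rV (R := R) d.

Let positivity_sets : set (set 'rV[R]_d) :=
  [set [set x | 0 < f x] | f in @smooth R d].

(** The product f g is also positive where both factors are negative; composing with [flat 0] first
    removes the negative values and keeps the positivity sets and smoothness. *)
Let positivity_sets_setI : setI_closed positivity_sets.
Proof.
move=> _ _ [f sf <-] [g sg <-]; exists ((flat 0 \o f) * (flat 0 \o g)).
  by apply: smoothM; exact: smooth_flat.
have E x : (0 < flat 0 x) = ((0 : R) < x).
  by rewrite lt_def flat_ge0 andbT flat_eq0 -ltNge.
apply/seteqP; split=> x /=; rewrite -[(_ * _) x]/(flat 0 (f x) * flat 0 (g x)).
  move=> h; have : 0 < flat 0 (f x).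
    by rewrite lt_def flat_ge0 andbT; apply: contraTneq h => ->; rewrite mul0r ltxx.
  move=> fx; move: h; rewrite pmulr_rgt0// E => gx.
  by split=> //; move: fx; rewrite E.
by move=> [fx gx]; rewrite mulr_gt0// E.
Qed.

Let measurable_positivity_sets : @measurable _ 'rV[R]_d = <<s positivity_sets >>.
Proof.
have sub2 : <<s positivity_sets >> `<=` @measurable _ 'rV[R]_d.
  apply: smallest_sub; first exact: sigma_algebra_measurable.
  move=> _ [f sf <-]; apply: measurable_open_rV.
  have /continuousP := smooth_continuous sf.
  by move=> /(_ _ (@open_gt R 0)).
apply/seteqP; split=> //.
apply: smallest_sub; first exact: smallest_sigma_algebra.
rewrite -bigcup_seq/= => _ [i _ [B mB <-]] /=; rewrite setTI.
have mi : @measurable_fun _ _ (g_sigma_algebraType positivity_sets) R setT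
    (fun x : 'rV[R]_d => x 0 i).
  apply: (measurability (@RGenOInfty.G R)); first exact: RGenOInfty.measurableE.
  move=> _ [_ [a ->] <-]; rewrite setTI; apply: sub_sigma_algebra.
  exists (cst (- a) + (fun x : 'rV[R]_d => x 0 i)).
    by apply: smoothD; [exact: smooth_cst|exact: smooth_coord].
  apply/seteqP; split=> x /=; rewrite in_itv/= andbT -[(_ + _) x]/(- a + x 0 i);
    by rewrite addrC subr_gt0.
by have := mi measurableT _ mB; rewrite setTI.
Qed.

Section weak.
Variables (U : set 'rV[R]_d) (g : 'rV[R]_d -> R).
Hypotheses (oU : open U) (bU : bounded_set U) (Lg : L2 U g)
  (g0 : forall phi, test_function U phi -> inner U g phi = 0).

Let mU : measurable U := measurable_open_rV oU.

Let integrable_test phi : test_function U phi ->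
  mu.-integrable U (fun x => (g x * phi x)%:E).
Proof. by move=> tphi; apply: L2_integrableM => //; exact: test_function_L2. Qed.

Let integral_test phi : test_function U phi ->
  (\int[mu]_(x in U) (g x * phi x)%:E = 0)%E.
Proof.
move=> tphi; rewrite -[LHS]fineK; first by rewrite -[fine _]/(inner U g phi) g0.
exact: integrable_fin_num (integrable_test tphi).
Qed.

(** The factor [phi] stays as a cutoff, so that every approximation of the indicator of [A]
    multiplied by it is again a test function in [U]. *)
Let integral_test_setI phi A : test_function U phi -> measurable A ->
  (\int[mu]_(x in U `&` A) (g x * phi x)%:E = 0)%E.
Proof.
move=> tphi mA.
have mS B : measurable B -> measurable (U `&` B) by move=> mB; exact: measurableI.
have iS B : measurable B -> mu.-integrable (U `&` B) (fun x => (g x * phi x)%:E).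
  by move=> mB; apply: integrableS (integrable_test tphi) => //; exact: mS.
move: A mA; rewrite measurable_positivity_sets.
apply: dynkin_induction => //.
- by rewrite setIT; exact: integral_test.
- move=> _ [f sf <-]; rewrite integral_mkcondr.
  pose h n x : \bar R := (g x * (flat 0 (n.+1%:R * f x) * phi x))%:E.
  have th n : test_function U ((flat 0 \o (cst n.+1%:R * f)) * phi).
    apply: test_functionM => //; apply: smooth_flat; apply: smoothM => //.
    exact: smooth_cst.
  have int1 := integrable_test tphi.
  have mf0 : measurable [set x | 0 < f x].
    by rewrite measurable_positivity_sets; apply: sub_sigma_algebra; exists f.
  (* The dominating function is |g phi|, because [flat 0] takes values in [0, 1]. *)
  have [|||||_ _] := @dominated_convergence _ _ _ mu U mU h
    ((fun x => (g x * phi x)%:E) \_ [set x | 0 < f x])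
    (fun x => `|(g x * phi x)%:E|%E).
  + by move=> n; exact: measurable_int (integrable_test (th n)).
  + apply/measurable_restrict => //.
    apply: (@measurable_funS _ _ _ _ U); [exact: mU|exact: subIsetl|].
    exact: measurable_int int1.
  + apply: aeW => x Ux; rewrite patchE; case: ifPn => [/set_mem/= fx|nfx].
      apply: cvg_EFin; first exact: nearW.
      rewrite -[X in _ --> g x * X]mul1r.
      apply: cvgMr; apply: cvgMl; exact: cvg_flat0.
    rewrite (_ : h^~ x = cst 0%E); first exact: cvg_cst.
    have fx : (0 < f x) = false by apply: contraNF nfx => fx; exact: mem_set.
    by apply/funext => n; rewrite /h /flat pmulr_rgt0// fx mul0r mulr0.
  + exact: integrable_abse.
  + apply: aeW => x n Ux; rewrite /h lee_fin !normrM ler_wpM2l//.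
    rewrite ler_piMl// ger0_norm ?flat_ge0//; exact: flat0_le1.
  rewrite (_ : [sequence _]_n = cst 0%E).
    by move/(cvg_lim (@ereal_hausdorff R)) => <-; rewrite lim_cst//; exact: ereal_hausdorff.
  by apply/funext => n; exact: (integral_test (th n)).
- move=> S mS' S0.
  have := integral_test tphi; rewrite -{1}(setIT U) -(setUv S) setIUr integral_setU//.
  + by rewrite S0 add0e.
  + exact: mS.
  + by apply: mS; exact: measurableC.
  + rewrite -setIUr setUv setIT; exact: measurable_int (integrable_test tphi).
  + apply/disj_setPS => x [[_ Sx] [_]]; exact.
- move=> F mF tF F0; rewrite setI_bigcupr integral_bigcup//.
  + by apply: eseries0 => i _ _; exact: F0.
  + exact: trivIset_setIl.
  + by move=> k; exact: mS.
  + by rewrite -setI_bigcupr; apply: iS; exact: bigcupT_measurable.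
Qed.

(** On each cube of a countable cover of [U] some test function has no zero. As the integrals of g
    phi over all Borel subsets of [U] vanish, g phi is zero almost everywhere, hence so is [g] on
    that cube. *)
Lemma fundamental_lemma : {ae mu, forall x, U x -> g x = 0}.
Proof.
have [F UF FP] := open_bigcup_ball oU.
suff : {ae mu, forall x k, F k x -> g x = 0}.
  by apply: filterS => x h; rewrite [in X in X -> _]UF => -[k _]; exact: h.
apply: ae_foralln => k; case: (FP k) => [->|[q [r [r0 -> sub]]]].
  exact: aeW.
have [phi tphi phiP] := ball_bump r0 sub.
have : ae_eq mu U (fun x => (g x * phi x)%:E) (cst 0%E).
  apply: integral_ae_eq => //; first exact: integrable_test.
  move=> E EU mE; rewrite integral0 -(setIidr EU); exact: integral_test_setI.
apply: filterS => x h bx; have Ux : U x.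
  by apply: sub => i; apply/ltW; move/ball_rVP : bx; exact.
have [] := h Ux => /eqP; rewrite mulf_eq0 (negbTE (phiP _ bx)) orbF => /eqP.
done.
Qed.

End weak.
End fundamental_lemma.

(** * Vanishing integral of a partial derivative *)

Section integration_by_parts.
Context {R : realType}.

Lemma cons_rVD n (t s : R) (x y : 'rV[R]_n) :
  cons_rV (t, x) + cons_rV (s, y) = cons_rV (t + s, x + y).
Proof. by apply/rowP => k; rewrite !mxE; case: unliftP => [j|] _ //=; rewrite mxE. Qed.

Lemma cons_rVZ n (a t : R) (x : 'rV[R]_n) :
  a *: cons_rV (t, x) = cons_rV (a * t, a *: x).
Proof. by apply/rowP => k; rewrite !mxE; case: unliftP => [j|] _ //=; rewrite mxE. Qed.

Lemma delta_mx_lift n (j : 'I_n) :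
  delta_mx 0 (lift ord0 j) = cons_rV (0, delta_mx 0 j) :> 'rV[R]_n.+1.
Proof.
apply/rowP => k; rewrite !mxE eqxx/=; case: unliftP => [i|] -> /=.
  by rewrite (inj_eq lift_inj) mxE eqxx.
by [].
Qed.

Lemma delta_mx_ord0 n : delta_mx 0 ord0 = cons_rV (1, 0) :> 'rV[R]_n.+1.
Proof.
apply/rowP => k; rewrite !mxE eqxx/=; case: unliftP => [i|] -> /=.
  by rewrite mxE.
by [].
Qed.

Lemma continuous_cons_rV1 n (x : 'rV[R]_n) : continuous (fun t : R => cons_rV (t, x)).
Proof.
move=> t A /nbhs_ballP[e /= e0 eA]; apply/nbhs_ballP; exists e => // s ts.
apply: eA; apply/ball_rVP => // i.
by rewrite !mxE; case: unliftP => [j|] _ /=; [rewrite subrr normr0 | exact: ts].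
Qed.

Lemma continuous_cons_rV2 n (t : R) : continuous (fun x : 'rV[R]_n => cons_rV (t, x)).
Proof.
move=> x A /nbhs_ballP[e /= e0 eA]; apply/nbhs_ballP; exists e => // y /ball_rVP xy.
apply: eA; apply/ball_rVP => // i.
by rewrite !mxE; case: unliftP => [j|] _ /=; [exact: xy | rewrite subrr normr0].
Qed.

Lemma integral_derive_compact_support (g : R -> R) (M : R) :
  (forall t, derivable g t 1) -> continuous (derive1 g) ->
  (forall t, M < `|t| -> g t = 0) ->
  (\int[lebesgue_measure]_t (derive1 g t)%:E = 0)%E.
Proof.
(* M' is positive even when M is negative, so the interval is nondegenerate and [g] vanishes at both
   ends. *)
move=> dg cg g0; pose M' := `|M| + 1.
have MM' : M < M' by rewrite /M' ltr_pwDr// ler_norm.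
have M'0 : 0 < M' by rewrite /M' ltr_pwDr.
have dg0 t : M < `|t| -> derive1 g t = 0.
  move=> Mt; rewrite derive1E (near_eq_derive (g := cst 0)) ?derive_cst//.
  have : nbhs `|t| [set y : R | M < y].
    by apply: open_nbhs_nbhs; split => //; exact: open_gt.
  move=> h; have h2 : \forall y \near t, M < `|y| := @norm_continuous R R^o t _ h.
  by near=> y; apply: g0; near: y.
transitivity (\int[lebesgue_measure]_(t in `[(- M')%R, M']) (derive1 g t)%:E)%E.
  rewrite [RHS]integral_mkcond; apply: eq_integral => t _.
  rewrite patchE; case: ifPn => // /negP tM; rewrite dg0//.
  rewrite ltNge; apply/negP => tM'; apply: tM; rewrite inE/= in_itv/=.
  by rewrite -ler_norml (le_trans tM')// ltW.
rewrite (continuous_FTC2 (F := g)).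
- by rewrite !g0 ?normrN ?gtr0_norm// subee.
- by rewrite gtrN.
- exact: continuous_subspaceT.
- have cgt : continuous g by move=> t; exact/differentiable_continuous/derivable1_diffP.
  split; first by move=> t _; exact: dg.
  + exact: cvg_at_right_filter (cgt _).
  + exact: cvg_at_left_filter (cgt _).
- by [].
Unshelve. all: by end_near. Qed.

Lemma integrable_bounded_support d (T : measurableType d)
    (m : {measure set T -> \bar R}) (A : set T) (f : T -> R) (M : R) :
  measurable A -> (m A < +oo)%E -> measurable_fun setT f ->
  (forall x, `|f x| <= M) -> (forall x, ~ A x -> f x = 0) ->
  m.-integrable setT (fun x => (f x)%:E).
Proof.
move=> mA Aoo mf fM f0.
have := @integrable_mkcond _ _ _ m A (fun x => (f x)%:E) mA.
rewrite (_ : _ \_ A = (fun x => (f x)%:E)).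
  move=> [h _]; apply: h; apply: measurable_bounded_integrable => //.
    exact: measurable_funTS.
  by exists M; split; [exact: num_real|move=> N MN x _; exact: le_trans (fM x) (ltW MN)].
apply/funext => x; rewrite patchE; case: ifPn => // /negP; rewrite inE => nA.
by rewrite f0.
Qed.

Lemma integral_lebesgue_rV_cons n (f : 'rV[R]_n.+1 -> \bar R) :
  measurable_fun setT f ->
  (@lebesgue_measure R \x lebesgue_rV n)%E.-integrable setT (f \o @cons_rV R n) ->
  (\int[lebesgue_rV n.+1]_x f x =
   \int[(@lebesgue_measure R \x lebesgue_rV n)%E]_z f (cons_rV z))%E.
Proof.
move=> mf intf.
(* measurable_cons_rV carries a different (convertible) display on R. *)
have mcons : @measurable_fun _ _ (measurableTypeR R * 'rV[R]_n)%type 'rV[R]_n.+1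
  setT (@cons_rV R n) := @measurable_cons_rV R n.
exact: (integral_pushforward mcons mf intf measurableT).
Qed.

(** Equality of the quotients as functions transfers both derivability and the value of the
    derivative between a function and its slices. *)
Lemma quotient_cons_lift n (chi : 'rV[R]_n.+1 -> R) (j : 'I_n) t (x : 'rV[R]_n) :
  (fun h : R => h^-1 *: (((fun y => chi (cons_rV (t, y))) \o shift x) (h *: delta_mx 0 j)
     - chi (cons_rV (t, x)))) =
  (fun h : R => h^-1 *: ((chi \o shift (cons_rV (t, x))) (h *: delta_mx 0 (lift ord0 j))
     - chi (cons_rV (t, x)))).
Proof.
by apply/funext => h /=; rewrite delta_mx_lift cons_rVZ cons_rVD mulr0 add0r.
Qed.

Lemma quotient_cons_ord0 n (chi : 'rV[R]_n.+1 -> R) t (x : 'rV[R]_n) :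
  (fun h : R => h^-1 *: (((fun s => chi (cons_rV (s, x))) \o shift t) (h *: 1)
     - chi (cons_rV (t, x)))) =
  (fun h : R => h^-1 *: ((chi \o shift (cons_rV (t, x))) (h *: delta_mx 0 ord0)
     - chi (cons_rV (t, x)))).
Proof.
apply/funext => h /=; rewrite delta_mx_ord0 cons_rVZ cons_rVD.
by rewrite scaler0 add0r mulr1 [h *: 1]mulr1.
Qed.

(** By Fubini and induction on the dimension. Regularity is asked only in the direction [i], a form
    that passes directly to slices. *)
Lemma integral_pderiv n (chi : 'rV[R]_n -> R) (i : 'I_n) (M : R) :
  (forall x, derivable chi x (delta_mx 0 i)) ->
  continuous (pderiv i chi : 'rV[R]_n -> R) ->
  (forall (x : 'rV[R]_n) j, M < `|x 0 j| -> chi x = 0) ->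
  (\int[lebesgue_rV n]_x (pderiv i chi x)%:E = 0)%E.
Proof.
elim: n => [|n IHn] in chi i *; first by case: i.
move=> dchi cchi chi0.
have dchi0 (x : 'rV[R]_n.+1) j : M < `|x 0 j| -> pderiv i chi x = 0.
  move=> Mx; rewrite /pderiv (near_eq_derive (g := cst 0)) ?derive_cst//.
  have : nbhs `|x 0 j| [set y : R | M < y].
    by apply: open_nbhs_nbhs; split => //; exact: open_gt.
  move=> h; have h1 := @norm_continuous R R^o (x 0 j) _ h.
  have h2 : nbhs x [set y : 'rV[R]_n.+1 | M < `|y 0 j|] := @coord_continuous R _ _ 0 j x _ h1.
  by near=> y; apply: (chi0 _ j); near: y.
pose A := [set x : 'rV[R]_n.+1 | forall i, - M <= x 0 i <= M].
have mA : measurable A by exact: measurable_cube.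
have f0 (x : 'rV[R]_n.+1) : ~ A x -> pderiv i chi x = 0.
  move=> /existsNP[j /negP]; rewrite -ler_norml -ltNge; exact: dchi0.
have [B fB] : exists B, forall x, `|pderiv i chi x| <= B.
  apply: compact_support_bounded => //.
  apply: (subclosed_compact _ (@compact_cube R n.+1 0 M)); first exact: closed_closure.
  rewrite [X in _ `<=` X](closure_id _).1; last exact: closed_cube.
  apply: closure_subset => x /= fx j; rewrite mxE sub0r normrN leNgt.
  by apply: contraNN fx => /dchi0 ->.
have mf : measurable_fun setT (pderiv i chi) by exact: continuous_measurable_rV.
have mcons : @measurable_fun _ _ (measurableTypeR R * 'rV[R]_n)%type 'rV[R]_n.+1
  setT (@cons_rV R n) := @measurable_cons_rV R n.
have mfc : @measurable_fun _ _ (measurableTypeR R * 'rV[R]_n)%type R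
    setT (pderiv i chi \o @cons_rV R n) by exact: measurableT_comp.
have intf : (@lebesgue_measure R \x lebesgue_rV n)%E.-integrable setT
    ((EFin \o pderiv i chi) \o @cons_rV R n).
  apply: (@integrable_bounded_support _ (measurableTypeR R * 'rV[R]_n)%type _
    (@cons_rV R n @^-1` A) _ B) => //.
  - by rewrite -[X in measurable X]setTI; exact: mcons.
  - exact: (lebesgue_rV_cube_lty n.+1 M).
  - by move=> z; exact: f0.
rewrite integral_lebesgue_rV_cons//; last exact/measurable_EFinP.
(* If [i] is not the first coordinate, the inner integral over the remaining coordinates vanishes by
   induction. Otherwise the first coordinate is integrated first and the fundamental theorem of
   calculus applies. *)
move: intf; case: (unliftP ord0 i) => [j|] ij intf.
  rewrite -integral12_prod_meas1// integral0_eq// => t _; rewrite /fubini_F/=.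
  transitivity (\int[lebesgue_rV n]_x (pderiv j (fun y => chi (cons_rV (t, y))) x)%:E)%E.
    by apply: eq_integral => x _; rewrite /pderiv /derive quotient_cons_lift ij.
  apply: IHn => [x||x k Mx].
  - by rewrite /derivable quotient_cons_lift -ij; exact: dchi.
  - rewrite (_ : pderiv j _ = fun x => pderiv i chi (cons_rV (t, x))); last first.
      by apply/funext => x; rewrite /pderiv /derive quotient_cons_lift ij.
    by move=> x; apply: continuous_comp; [exact: continuous_cons_rV2|exact: cchi].
  - by apply: (chi0 _ (lift ord0 k)); rewrite mxE liftK.
rewrite -integral21_prod_meas1// integral0_eq// => x _; rewrite /fubini_G/=.
have E : derive1 (fun s : R => chi (cons_rV (s, x))) = fun t => pderiv i chi (cons_rV (t, x)).
  by apply/funext => t; rewrite derive1E /pderiv /derive quotient_cons_ord0 ij.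
rewrite -[RHS](@integral_derive_compact_support (fun s : R => chi (cons_rV (s, x))) M).
- by apply: eq_integral => t _; rewrite E.
- by move=> t; rewrite /derivable quotient_cons_ord0 -ij; exact: dchi.
- by rewrite E => t; apply: continuous_comp; [exact: continuous_cons_rV1|exact: cchi].
- by move=> t Mt; apply: (chi0 _ ord0); rewrite mxE unlift_none.
Unshelve. all: by end_near. Qed.

End integration_by_parts.

(** * Null hyperplanes and interiors of simplices *)

Section null_sets.
Context {R : realType}.

Lemma measurable_hyperplane n (a : 'rV[R]_n) (b : R) :
  measurable [set x | dot x a = b].
Proof.
rewrite (_ : mkset _ = (fun x => dot x a) @^-1` [set b]); last by [].
rewrite -[X in measurable X]setTI; suff : measurable_fun setT (fun x => dot x a).
  by move=> /(_ measurableT _ (measurable_set1 b)).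
apply: measurable_sum => i; apply: measurable_funM; last exact: measurable_cst.
exact: measurable_coord.
Qed.

(** Slicing along the first coordinate: if the other coefficients are not all zero, each slice is a
    hyperplane of lower dimension; otherwise the set is a point times the whole space. *)
Lemma hyperplane_null n (a : 'rV[R]_n) (b : R) : a != 0 ->
  lebesgue_rV n [set x | dot x a = b] = 0%E.
Proof.
elim: n => [|n IHn] in a b *; first by rewrite thinmx0 eqxx.
move=> a0; pose a' := \row_j a 0 (lift ord0 j) : 'rV[R]_n.
have dotE t x : dot (cons_rV (t, x)) a = t * a 0 ord0 + dot x a'.
  rewrite /dot big_ord_recl !mxE unlift_none; congr (_ + _).
  by apply: eq_bigr => j _; rewrite !mxE liftK.
rewrite [LHS](_ : _ = (@lebesgue_measure R \x lebesgue_rV n)%E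
  (cons_rV (n := n) @^-1` [set x | dot x a = b]))//.
have [a'0|a'n0] := eqVneq a' 0; last first.
  rewrite /product_measure1 integral0_eq// => t _ /=.
  rewrite [X in lebesgue_rV n X](_ : _ = [set x | dot x a' = b - t * a 0 ord0]).
    exact: IHn.
  apply/seteqP; split=> x /=; rewrite /xsection/= ?inE/= dotE.
    by move=> <-; rewrite addrAC subrr add0r.
  by move=> ->; rewrite addrC subrK.
have a00 : a 0 ord0 != 0.
  apply: contra a0 => /eqP a00; apply/eqP/rowP => k; rewrite mxE.
  case: (unliftP ord0 k) => [j|] -> //.
  by have := congr1 (fun M : 'rV_n => M 0 j) a'0; rewrite /a' !mxE.
rewrite (_ : _ @^-1` _ = [set b / a 0 ord0] `*` setT).
  have s0 : lebesgue_measure [set b / a 0 ord0] = 0%E by exact: lebesgue_measure_set1.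
  (* The second factor may have infinite measure; the convention that 0 times +oo is 0 settles this
     case. *)
  rewrite product_measure1E//; transitivity (0 * lebesgue_rV n [set: 'rV[R]_n])%E.
    by congr (_ * _)%E; exact: s0.
  by rewrite mul0e.
have dot0 x : dot x a' = 0 by rewrite a'0 /dot big1// => j _; rewrite mxE mulr0.
apply/seteqP; split=> -[t x] /=; rewrite dotE dot0 addr0.
  by move=> <-; rewrite mulfK.
by move=> [-> _]; rewrite divfK.
Qed.

Lemma continuous_dot n (a : 'rV[R]_n) : continuous (fun x => dot x a).
Proof.
rewrite /dot; elim: (index_enum _) => [|j s IHs].
  rewrite (_ : (fun _ => _) = cst 0); first exact: cst_continuous.
  by apply/funext => y; rewrite big_nil.
rewrite (_ : (fun _ => _) = (fun y : 'rV[R]_n => y 0 j * a 0 j + \sum_(k <- s) y 0 k * a 0 k)).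
  by move=> x; exact: (cvgD (cvgMl (@coord_continuous R _ _ 0 j x)) (IHs x)).
by apply/funext => y; rewrite big_cons.
Qed.

(** [V] is the set of points whose barycentric coordinates [lam] are all positive. These are affine
    in the point, so the rest of the simplex lies in finitely many null sets. *)
Lemma simplex_interior_ae d (K : 'M[R]_(d.+1, d)) : Defs.nondegenerate K ->
  exists V : set 'rV[R]_d, [/\ open V, V `<=` simplex K &
    {ae lebesgue_rV d, forall x, simplex K x -> V x}].
Proof.
move=> ndK; pose B := row_mx K (const_mx 1 : 'cV[R]_d.+1).
have {}ndK : row_free B := ndK.
have /row_freeP[B' BB'] := ndK.
(* [B] has d.+1 rows and d + 1 columns, equal numbers but not convertible ones; the right inverse is
   shown to be a left inverse through ranks. *)
have BfB : B' *m B = 1%:M.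
  have /row_fullP[C CB] : row_full B.
    by rewrite /row_full; apply/eqP; rewrite (eqP ndK) addn1.
  by rewrite -[LHS]mul1mx -CB -[LHS]mulmxA (mulmxA B) BB' mul1mx.
pose lam (x : 'rV[R]_d) := row_mx x (const_mx 1 : 'cV_1) *m B'.

have lamE x i : lam x 0 i = dot x (row i (usubmx B')^T) + dsubmx B' 0 i.
  rewrite /lam -[in LHS](vsubmxK B') mul_row_col !mxE; congr (_ + _).
    by apply: eq_bigr => j _; rewrite !mxE.
  by rewrite big_ord1 !mxE mul1r.
have lamK x : lam x *m K = x /\ \sum_i lam x 0 i = 1.
  have : lam x *m B = row_mx x (const_mx 1 : 'cV_1).
    by rewrite /lam -mulmxA BfB mulmx1.
  rewrite /B mul_mx_row => /eq_row_mx[-> h]; split => //.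
  have := congr1 (fun M : 'cV_1 => M 0 0) h; rewrite !mxE => <-.
  by apply: eq_bigr => i _; rewrite !mxE mulr1.
have lam_uniq (l : 'rV[R]_d.+1) : \sum_i l 0 i = 1 -> lam (l *m K) = l.
  move=> l1; rewrite -[RHS]mulmx1 -BB' mulmxA /B mul_mx_row; congr (row_mx _ _ *m _).
  apply/rowP => j; rewrite !ord1 !mxE -[LHS]l1.
  by apply: eq_bigr => i _; rewrite !mxE mulr1.
exists [set x | forall i, 0 < lam x 0 i]; split.
- rewrite openE => x xV.
  suff : nbhs x [set y | forall i, 0 < lam y 0 i] by [].
  apply: (@filter_forall _ _ (fun i y => 0 < lam y 0 i) (nbhs x)) => i.
  have cl : continuous (fun x => lam x 0 i).
    rewrite (_ : (fun x => _) = (fun x => dot x (row i (usubmx B')^T) + dsubmx B' 0 i)).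
      move=> y.
      exact: (cvgD (@continuous_dot d (row i (usubmx B')^T) y) (@cvg_cst _ _ _ _ _)).
    by apply/funext => y; rewrite lamE.
  have lx : nbhs (lam x 0 i) [set t : R | 0 < t].
    by apply: open_nbhs_nbhs; split; [exact: open_gt|exact: xV].
  exact: (cl x _ lx).
- move=> x xV; exists (lam x); last by have [] := lamK x.
  split; [by move=> i; exact/ltW/xV| |by have [] := lamK x].
  by move=> i; rewrite inE.
- suff : {ae lebesgue_rV d, forall x, forall i, lam x 0 i <> 0}.
    apply: filterS => x h [l [l0 _ l1] lx] i.
    by have := h i; rewrite -lx lam_uniq// => /eqP li; rewrite lt_neqAle eq_sym li l0.
  apply: (@filter_forall _ _ (fun i x => lam x 0 i <> 0)) => i.
  (* If the linear part vanishes, the zero set is not a hyperplane; but then the coordinate is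
     constant, and its value at vertex [i] is 1. *)
  have [a0|a0] := eqVneq (row i (usubmx B')^T) 0.
    have lamc x : lam x 0 i = dsubmx B' 0 i.
      by rewrite lamE a0 /dot big1 ?add0r// => j _; rewrite mxE mulr0.
    apply: aeW => x; have := lam_uniq (delta_mx 0 i).
    rewrite lamc -(lamc (delta_mx 0 i *m K)) => ->.
      by rewrite mxE !eqxx; exact/eqP/oner_neq0.
    rewrite (bigD1 i)//= mxE !eqxx big1 ?addr0// => j ji.
    by rewrite mxE eqxx (negbTE ji).
  exists [set x | dot x (row i (usubmx B')^T) = - dsubmx B' 0 i]; split.
  - exact: measurable_hyperplane.
  - exact: hyperplane_null.
  - by move=> x /= /contrapT; rewrite lamE => /eqP; rewrite addr_eq0 => /eqP.
Qed.

End null_sets.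

(** * Polynomial functions, formal derivatives and degrees *)

Section polynomials.
Context {R : realType} {d : nat}.
Implicit Types (P Q : mpoly.mpoly d R) (i j : 'I_d).

Let has_formal_derivative P :=
  continuous (polyfun P : 'rV[R]_d -> R) /\
  forall i (x : 'rV[R]_d), is_derive x (delta_mx 0 i) (polyfun P)
    (polyfun (mpoly.mderiv i P) x).

Let formalD P Q : has_formal_derivative P -> has_formal_derivative Q ->
  has_formal_derivative (P + Q).
Proof.
have E P' Q' : polyfun (P' + Q') = (polyfun P' + polyfun Q')%R :> ('rV[R]_d -> R).
  by apply/funext => x; rewrite /polyfun mpoly.mevalD.
move=> [cP dP] [cQ dQ]; split; first by rewrite E => x; exact: (cvgD (cP x) (cQ x)).
by move=> i x; rewrite E mpoly.mderivD E; exact: is_deriveD.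
Qed.

Let formalM P Q : has_formal_derivative P -> has_formal_derivative Q ->
  has_formal_derivative (P * Q).
Proof.
have E P' Q' : polyfun (P' * Q') = (polyfun P' * polyfun Q')%R :> ('rV[R]_d -> R).
  by apply/funext => x; rewrite /polyfun mpoly.mevalM.
move=> [cP dP] [cQ dQ]; split; first by rewrite E => x; exact: (cvgM (cP x) (cQ x)).
move=> i x; rewrite E mpoly.mderivM.
apply: is_derive_eq; rewrite /polyfun mpoly.mevalD !mpoly.mevalM /GRing.scale/=.
by rewrite addrC (mulrC (mpoly.meval _ Q)).
Qed.

Let formalC (c : R) : has_formal_derivative (mpoly.mpolyC d c).
Proof.
have E c' : polyfun (mpoly.mpolyC d c') = cst c' :> ('rV[R]_d -> R).
  by apply/funext => x; rewrite /polyfun mpoly.mevalC.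
split; first by rewrite E; exact: cst_continuous.
by move=> i x; rewrite mpoly.mderivC -mpoly.mpolyC0 !E; exact: is_derive_cst.
Qed.

Let formalX j : has_formal_derivative (mpoly.mpolyX R (mpoly.mnm1 j)).
Proof.
have E : polyfun (mpoly.mpolyX R (mpoly.mnm1 j)) = (fun x : 'rV[R]_d => x 0 j).
  by apply/funext => x; rewrite /polyfun mpoly.mevalXU.
split; first by rewrite E; exact: coord_continuous.
move=> i x; rewrite E; apply: is_derive_eq; first exact: is_derive_coord.
rewrite mpoly.mderivX mpoly.mnm1E eq_sym /polyfun mpoly.mevalZ.
have [<-|_] := eqVneq i j; last by rewrite mul0r.
by rewrite mul1r mpoly.mevalX big1// => k _; rewrite mpoly.mnmBE subnn expr0.
Qed.

Lemma polyfun_has_formal_derivative P : has_formal_derivative P.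
Proof.
elim/mpoly.mpolyind: P => [|c m P _ _ IHP].
  by rewrite -mpoly.mpolyC0; exact: formalC.
apply: formalD => //; rewrite -mpoly.mul_mpolyC; apply: formalM; first exact: formalC.
rewrite mpoly.mpolyXE_id; elim/big_ind : _ => [||j _].
- by rewrite -mpoly.mpolyC1; exact: formalC.
- exact: formalM.
- elim: (mpoly.fun_of_multinom m j) => [|k IHk].
    by rewrite expr0 -mpoly.mpolyC1; exact: formalC.
  by rewrite exprS; exact: formalM.
Qed.

Lemma pderiv_polyfun i P : pderiv i (polyfun P) = polyfun (mpoly.mderiv i P).
Proof.
apply/funext => x; have [_ dP] := polyfun_has_formal_derivative P.
by have [] := dP i x.
Qed.

Lemma smooth_polyfun P : smooth (polyfun P).
Proof.
apply: (@smooth_subset _ _ (range (@polyfun R d))); last by exists P.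
  by move=> _ [Q _ <-]; have [] := polyfun_has_formal_derivative Q.
move=> _ i [Q _ <-]; exists (polyfun (mpoly.mderiv i Q)); first by exists (mpoly.mderiv i Q).
by have [_] := polyfun_has_formal_derivative Q; exact.
Qed.

Lemma degree_le_mderiv p i P : degree_le p.+1 P -> degree_le p (mpoly.mderiv i P).
Proof.
rewrite /degree_le => degP; rewrite /mpoly.mderiv.
apply: leq_trans (mpoly.mmeasure_sum _ _ _ _) _.
apply/bigmax_leqP_seq => m mP _.
(* When X_i does not divide the monomial, truncated subtraction of exponents would not lower the
   degree; the zero coefficient removes that term. *)
have [m0|m0] := eqVneq (mpoly.fun_of_multinom m i) 0%N.
  by rewrite m0 mul0r scale0r mpoly.mmeasure0.
apply: leq_trans (mpoly.mmeasureZ_le _ _ _) _; rewrite mpoly.mmeasureX.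
have mdegP := leq_trans (mpoly.msize_mdeg_lt mP) degP.
rewrite -ltnS; apply: leq_trans mdegP.
rewrite ltnS -[in X in (_ < X)%N](@mpoly.submK _ (mpoly.mnm1 i) m).
  by rewrite mpoly.mdegD mpoly.mdeg1 addn1.
apply/mpoly.mnm_lepP => k; rewrite mpoly.mnm1E.
by case: eqVneq => // <-; rewrite lt0n.
Qed.

Lemma degree_leD p P Q : degree_le p P -> degree_le p Q -> degree_le p (P + Q).
Proof.
move=> hP hQ; apply: leq_trans (mpoly.mmeasureD_le _ _ _) _.
by rewrite geq_max hP hQ.
Qed.

Lemma degree_leN p P : degree_le p P -> degree_le p (- P).
Proof. by rewrite /degree_le mpoly.mmeasureN. Qed.

Lemma degree_le_sum p (F : 'I_d -> mpoly.mpoly d R) :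
  (forall i, degree_le p (F i)) -> degree_le p (\sum_i F i).
Proof.
move=> hF; apply: leq_trans (mpoly.mmeasure_sum _ _ _ _) _.
by apply/bigmax_leqP => i _; exact: hF.
Qed.

Lemma degree_leMX p P i : degree_le p P ->
  degree_le p.+1 (P * mpoly.mpolyX R (mpoly.mnm1 i)).
Proof.
rewrite /degree_le => hP; have [->|P0] := eqVneq P 0.
  by rewrite mul0r mpoly.mmeasure0.
have X0 : mpoly.mpolyX R (mpoly.mnm1 i) != 0.
  by rewrite -mpoly.msize_poly_eq0 mpoly.mmeasureX.
by rewrite mpoly.msizeM// mpoly.msizeX mpoly.mdeg1 addn2.
Qed.

End polynomials.

(** * Restriction to subdomains and integration by parts *)

Section restriction.
Context {R : realType} {d : nat}.
Implicit Types (f g phi : 'rV[R]_d -> R) (U Omega : set 'rV[R]_d).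

Lemma L2_sub U Omega f : measurable U -> measurable Omega -> U `<=` Omega ->
  L2 Omega f -> L2 U f.
Proof.
move=> mU mO UO [mf if2]; split; first exact: measurable_funS mf.
exact: integrableS if2.
Qed.

Lemma continuous_L2 U f : measurable U -> bounded_set U -> continuous f -> L2 U f.
Proof.
move=> mU bU cf; have [M UM] := bounded_rV_cube bU.
have cK := @compact_cube R d 0 M.
have /compact_bounded[B [_ BP]] : compact
    (f @` [set y : 'rV[R]_d | forall i, `|(0 : 'rV[R]_d) 0 i - y 0 i| <= M]).
  by apply: continuous_compact => //; exact: continuous_subspaceT.
apply: (bounded_L2 mU (M := `|B| + 1)).
- exact: bounded_rV_lty.
- by apply: measurable_funTS; exact: continuous_measurable_rV.
- move=> x Ux; apply: (BP (`|B| + 1)); first by rewrite ltr_pwDr// ler_norm.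
  by exists x => // i; rewrite mxE sub0r normrN ler_norml; exact: UM.
Qed.

Lemma inner_sub U Omega f g : measurable U -> U `<=` Omega ->
  (forall x, ~ U x -> g x = 0) -> inner U f g = inner Omega f g.
Proof.
move=> mU UO g0; rewrite /inner -{1}(setIidr UO) Rintegral_mkcondr.
apply: eq_Rintegral => x _; rewrite patchE; case: ifPn => // /negP.
by rewrite inE => nUx; rewrite g0// mulr0.
Qed.

Lemma inner_suml U (F : 'I_d -> 'rV[R]_d -> R) g : measurable U ->
  (forall i, L2 U (F i)) -> L2 U g ->
  inner U (fun x => \sum_i F i x) g = \sum_i inner U (F i) g.
Proof.
move=> mU LF Lg.
suff [] : L2 U (fun x => \sum_i F i x) /\
  inner U (fun x => \sum_i F i x) g = \sum_i inner U (F i) g by [].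
elim: (index_enum _) => [|j s [IHL IHs]].
  have E : (fun x : 'rV[R]_d => \sum_(i <- [::]) F i x) = fun=> 0.
    by apply/funext => x; rewrite big_nil.
  rewrite E big_nil; split; first exact: L2_0.
  by rewrite /inner; under eq_Rintegral do rewrite mul0r; rewrite Rintegral_cst// mul0r.
have E : (fun x : 'rV[R]_d => \sum_(i <- j :: s) F i x) =
    fun x => 1 * F j x + \sum_(i <- s) F i x.
  by apply/funext => x; rewrite big_cons mul1r.
rewrite E big_cons; split; first exact: L2_comb.
by rewrite inner_combl// mul1r IHs.
Qed.

(** [f] has no compact support, but f phi does; the integral of the derivative of this product
    vanishes. *)
Lemma integration_by_parts U f phi i : open U -> bounded_set U -> smooth f ->
  test_function U phi -> inner U f (pderiv i phi) = - inner U (pderiv i f) phi.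
Proof.
move=> oU bU sf tphi; have mU := measurable_open_rV oU.
have [sphi _ _] := tphi.
have tfphi : test_function U (f * phi) by exact: test_functionM.
have Lf : L2 U f by apply: continuous_L2 => //; exact: smooth_continuous.
have Ldf : L2 U (pderiv i f).
  by apply: continuous_L2 => //; apply: smooth_continuous; exact: smooth_pderiv.
have Lphi : L2 U phi by exact: test_function_L2.
have Ldphi : L2 U (pderiv i phi).
  by apply: test_function_L2 => //; exact: test_function_pderiv.
apply/eqP; rewrite -addr_eq0; apply/eqP.
rewrite /inner -RintegralD//; [|exact: L2_integrableM..].
have [M UM] := bounded_rV_cube bU.
have := @integral_pderiv R d (f * phi) i M.
(* The derivative of f phi vanishes off [U], so the integral over the whole space is the one over
   [U]. *)
rewrite (_ : (\int[_]_x _)%E = (\int[lebesgue_rV d]_(x in U) (pderiv i (f * phi) x)%:E)%E).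
  move=> h; rewrite /Rintegral.
  rewrite (_ : (\int[_]_(x in U) _)%E =
      (\int[lebesgue_rV d]_(x in U) (pderiv i (f * phi) x)%:E)%E).
    rewrite h//.
    - by move=> x; have [] := smooth_is_derive i x (smoothM sf sphi).
    - by apply: smooth_continuous; apply: smooth_pderiv; exact: smoothM.
    - move=> x j Mx; apply: test_function_out tfphi _ => Ux.
      by move: Mx; rewrite ltNge ler_norml UM.
  apply: eq_integral => x _; rewrite pderivM//; congr (_%:E).
  by rewrite -[RHS]/(f x * pderiv i phi x + phi x * pderiv i f x) (mulrC (phi x)).
rewrite [RHS]integral_mkcond; apply: eq_integral => x _.
rewrite patchE; case: ifPn => // /negP; rewrite inE => nUx.
by rewrite (test_function_out (test_function_pderiv i tfphi) nUx).
Qed.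

End restriction.

(** * Weak divergence of Raviart-Thomas-Nedelec fields *)

Section weak_divergence_RTN.
Context {R : realType} {d : nat}.

(** A test function supported in the open part of a simplex sees a single polynomial piece of [v],
    so there the weak identity becomes a classical integration by parts. This makes the divergence
    of eps an admissible test function for the projection. *)
Lemma RTN_weak_div (Omega : set 'rV[R]_d) (T : seq 'M[R]_(d.+1, d)) (p : nat) v g :
  open Omega -> bounded_set Omega ->
  (forall K, K \in T -> Defs.nondegenerate K) ->
  RTN Omega T p v -> is_weak_div Omega v g -> Pm Omega T p g.
Proof.
move=> oO bO ndT [Lv vK] [Lg wg]; split => // K KT.
have mO := measurable_open_rV oO.
have [P [Q [degP degQ vPQ]]] := vK K KT.
(* The components of P + Q x have degree p + 1; one differentiation brings the divergence back to
   degree p. *)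
pose S i := P i + Q * mpoly.mpolyX R (mpoly.mnm1 i).
have degS i : degree_le p.+1 (S i).
  by apply: degree_leD; [exact: leq_trans (degP i) _ | exact: degree_leMX].
have {}vPQ : {ae lebesgue_rV d, forall x, (Omega `&` simplex K) x ->
    forall i, v x 0 i = polyfun (S i) x}.
  apply: filterS vPQ => x h /h -> i.
  by rewrite !mxE /S /polyfun mpoly.mevalD mpoly.mevalM mpoly.mevalXU.
pose D := \sum_i mpoly.mderiv i (S i).
exists D; first by apply: degree_le_sum => i; exact: degree_le_mderiv.
have [V [oV VK KV]] := simplex_interior_ae (ndT K KT).
pose U := Omega `&` V.
have oU : open U by exact: openI.
have UO : U `<=` Omega by exact: subIsetl.
have bU : bounded_set U.
  by have [M [Mr MP]] := bO; exists M; split=> // N MN x [Ox _]; exact: MP Ox.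
have mU := measurable_open_rV oU.
have LD P' : L2 U (polyfun P').
  by apply: continuous_L2 => //; apply: smooth_continuous; exact: smooth_polyfun.
have LgU : L2 U g by exact: L2_sub Lg.
have h0 : {ae lebesgue_rV d, forall x, U x -> g x - polyfun D x = 0}.
  apply: fundamental_lemma => //; first exact: L2B.
  move=> phi tphi; have tO : test_function Omega phi := test_function_sub UO tphi.
  have Lphi : L2 U phi by exact: test_function_L2.
  have Ldphi i : L2 U (pderiv i phi).
    by apply: test_function_L2 => //; exact: test_function_pderiv.
  rewrite innerBl//; apply/eqP; rewrite subr_eq0; apply/eqP.
  rewrite (inner_sub (Omega := Omega))//; last by move=> x; exact: test_function_out.
  rewrite -[LHS]opprK -wg// innervE//; last exact: test_function_L2_grad.
  rewrite (_ : polyfun D = fun x => \sum_i polyfun (mpoly.mderiv i (S i)) x); last first.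
    by apply/funext => x; rewrite /D /polyfun raddf_sum.
  rewrite inner_suml// -sumrN; apply: eq_bigr => i _.
  rewrite (_ : (fun x => grad phi x 0 i) = pderiv i phi); last first.
    by apply/funext => x; rewrite mxE.
  rewrite -(inner_sub (U := U))//; last first.
    by move=> x; apply: test_function_out; exact: test_function_pderiv.
  rewrite (@eq_inner_ae _ _ _ mU _ (polyfun (S i)))//; last first.
  - by apply: filterS vPQ => x h [Ox Vx]; apply: h; split=> //; exact: VK.
  - by apply: L2_sub (Lv i).
  rewrite integration_by_parts//; last exact: smooth_polyfun.
  by rewrite pderiv_polyfun opprK.
apply: filterS2 KV h0 => x Vx h [Ox Kx].
by apply/eqP; rewrite -subr_eq0; apply/eqP/h; split=> //; exact: Vx.
Qed.

End weak_divergence_RTN.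

(** * Weak derivatives, Green's formula and Friedrichs' inequality *)

Section sobolev.
Context {R : realType} {d : nat} (Omega : set 'rV[R]_d).
Hypotheses (oO : open Omega) (bO : bounded_set Omega).
Implicit Types (f g h u w phi : 'rV[R]_d -> R) (v z G H : 'rV[R]_d -> 'rV[R]_d).

Let mO : measurable Omega := measurable_open_rV oO.

(** The limit passage for [H10]: an identity known on test functions holds up to e K, with K
    independent of the approximating function. *)
Lemma le_eps_eq0 (x K : R) : 0 <= K -> (forall e, 0 < e -> `|x| <= e * K) -> x = 0.
Proof.
move=> K0 h; apply/eqP; rewrite -normr_le0; apply/ler_addgt0Pl => e e0; rewrite addr0.
have K1 : 0 < K + 1 by rewrite ltr_pwDr.
apply: le_trans (h (e / (K + 1)) _) _; first by rewrite divr_gt0.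
by rewrite mulrAC ler_pdivrMr// ler_pM2l// lerDl.
Qed.

Lemma innerBr f g h : L2 Omega f -> L2 Omega g -> L2 Omega h ->
  inner Omega h (fun x => f x - g x) = inner Omega h f - inner Omega h g.
Proof. by move=> Lf Lg Lh; rewrite innerC innerBl// !(innerC _ h). Qed.

Lemma innervBr v y z : L2v Omega v -> L2v Omega y -> L2v Omega z ->
  innerv Omega z (fun x => v x - y x) = innerv Omega z v - innerv Omega z y.
Proof. by move=> Lv Ly Lz; rewrite innervC innervBl// !(innervC _ z). Qed.

Lemma innervDr v y z : L2v Omega v -> L2v Omega y -> L2v Omega z ->
  innerv Omega z (fun x => v x + y x) = innerv Omega z v + innerv Omega z y.
Proof. by move=> Lv Ly Lz; rewrite innervC innervDl// !(innervC _ z). Qed.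

Lemma norm2_triangleB f g : L2 Omega f -> L2 Omega g ->
  norm2 Omega (fun x => f x - g x) <= norm2 Omega f + norm2 Omega g.
Proof.
move=> Lf Lg; rewrite (_ : (fun x => _) = (fun x => 1 * f x + -1 * g x)).
  have LNg : L2 Omega (fun x => -1 * g x).
    rewrite (_ : (fun x => _) = fun x => 0 - g x); first exact: (L2B mO (L2_0 _) Lg).
    by apply/funext => x; ring.
  apply: le_trans (form_Minkowski (L2_comb mO) (inner_combl mO) (@innerC _ _ _)
    (@inner_ge0 _ _ _) Lf LNg) _.
  rewrite lerD2l le_eqVlt; apply/orP; left; apply/eqP; congr Num.sqrt.
  by apply: eq_Rintegral => x _; ring.
by apply/funext => x; ring.
Qed.

Lemma H1_weak_grad u : H1 Omega u -> is_weak_grad Omega u (wgrad Omega u).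
Proof. by move=> [_ exG]; exact: xgetPex. Qed.

Lemma H1_L2 u : H1 Omega u -> L2 Omega u. Proof. by case. Qed.

Lemma L2v_wgrad u : H1 Omega u -> L2v Omega (wgrad Omega u).
Proof. by move=> /H1_weak_grad[]. Qed.

Lemma Hdiv_weak_div v : Hdiv Omega v -> is_weak_div Omega v (wdiv Omega v).
Proof. by move=> [_ exg]; exact: xgetPex. Qed.

Lemma Hdiv_L2 v : Hdiv Omega v -> L2v Omega v. Proof. by case. Qed.

Lemma L2_wdiv v : Hdiv Omega v -> L2 Omega (wdiv Omega v).
Proof. by move=> /Hdiv_weak_div[]. Qed.

(** Turns the almost-everywhere conclusion of [fundamental_lemma] into the pairing form in which
    weak derivatives are compared. *)
Lemma inner_orthogonal_test g h : L2 Omega g -> L2 Omega h ->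
  (forall phi, test_function Omega phi -> inner Omega g phi = 0) ->
  inner Omega g h = 0.
Proof.
move=> Lg Lh g0; have g_ae := fundamental_lemma oO bO Lg g0.
rewrite (eq_inner_ae mO Lg (L2_0 _) Lh g_ae) /inner.
by under eq_Rintegral do rewrite mul0r; rewrite Rintegral_cst// mul0r.
Qed.

Lemma weak_gradB u w G H : L2 Omega u -> L2 Omega w ->
  is_weak_grad Omega u G -> is_weak_grad Omega w H ->
  is_weak_grad Omega (fun x => u x - w x) (fun x => G x - H x).
Proof.
move=> Lu Lw [LG wG] [LH wH]; split; first exact: L2vB.
move=> phi tphi i; have Lphi := test_function_L2 mO bO tphi.
have Ldphi := test_function_L2 mO bO (test_function_pderiv i tphi).
rewrite innerBl// wG// wH//.
rewrite (_ : (fun x => (G x - H x) 0 i) = (fun x => G x 0 i - H x 0 i)).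
  by rewrite innerBl//; lra.
by apply/funext => x; rewrite !mxE.
Qed.

Lemma weak_divB v z g h : L2v Omega v -> L2v Omega z ->
  is_weak_div Omega v g -> is_weak_div Omega z h ->
  is_weak_div Omega (fun x => v x - z x) (fun x => g x - h x).
Proof.
move=> Lv Lz [Lg wg] [Lh wh]; split; first exact: L2B.
move=> phi tphi; have Lphi := test_function_L2 mO bO tphi.
have Ldphi := test_function_L2_grad mO bO tphi.
by rewrite innervBl// wg// wh// innerBl//; lra.
Qed.

Lemma weak_grad_unique u G H z : is_weak_grad Omega u G -> is_weak_grad Omega u H ->
  L2v Omega z -> innerv Omega G z = innerv Omega H z.
Proof.
move=> [LG wG] [LH wH] Lz; rewrite !innervE//; apply: eq_bigr => i _.
apply/eqP; rewrite -subr_eq0 -innerBl//; apply/eqP.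
apply: inner_orthogonal_test => //; first exact: L2B.
move=> phi tphi; have Lphi := test_function_L2 mO bO tphi.
by rewrite innerBl//; have := wG _ tphi i; have := wH _ tphi i; lra.
Qed.

Lemma weak_div_unique v g h f : is_weak_div Omega v g -> is_weak_div Omega v h ->
  L2 Omega f -> inner Omega g f = inner Omega h f.
Proof.
move=> [Lg wg] [Lh wh] Lf; apply/eqP; rewrite -subr_eq0 -innerBl//; apply/eqP.
apply: inner_orthogonal_test => //; first exact: L2B.
move=> phi tphi; have Lphi := test_function_L2 mO bO tphi.
by rewrite innerBl//; have := wg _ tphi; have := wh _ tphi; lra.
Qed.

Lemma H1B u w : H1 Omega u -> H1 Omega w -> H1 Omega (fun x => u x - w x).
Proof.
move=> Hu Hw; have [Lu _] := Hu; have [Lw _] := Hw; split; first exact: L2B.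
exists (fun x => wgrad Omega u x - wgrad Omega w x).
by apply: weak_gradB => //; exact: H1_weak_grad.
Qed.

(** The representative chosen for the gradient of u - w need not equal the difference of the two
    chosen ones pointwise, so linearity is asserted only after pairing with an L^2 field. *)
Lemma innerv_wgradB u w z : H1 Omega u -> H1 Omega w -> L2v Omega z ->
  innerv Omega (wgrad Omega (fun x => u x - w x)) z =
  innerv Omega (wgrad Omega u) z - innerv Omega (wgrad Omega w) z.
Proof.
move=> Hu Hw Lz.
rewrite -innervBl//; [|exact: L2v_wgrad..].
apply: weak_grad_unique => //; first exact: H1_weak_grad (H1B Hu Hw).
by apply: weak_gradB; [exact: H1_L2..|exact: H1_weak_grad|exact: H1_weak_grad].
Qed.

Lemma HdivB v z : Hdiv Omega v -> Hdiv Omega z -> Hdiv Omega (fun x => v x - z x).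
Proof.
move=> Hv Hz; split; first exact: L2vB (Hdiv_L2 Hv) (Hdiv_L2 Hz).
exists (fun x => wdiv Omega v x - wdiv Omega z x).
by apply: weak_divB; [exact: Hdiv_L2..|exact: Hdiv_weak_div|exact: Hdiv_weak_div].
Qed.

Lemma inner_wdivB v z f : Hdiv Omega v -> Hdiv Omega z -> L2 Omega f ->
  inner Omega (wdiv Omega (fun x => v x - z x)) f =
  inner Omega (wdiv Omega v) f - inner Omega (wdiv Omega z) f.
Proof.
move=> Hv Hz Lf.
rewrite -innerBl//; [|exact: L2_wdiv..].
apply: weak_div_unique => //; first exact: Hdiv_weak_div (HdivB Hv Hz).
by apply: weak_divB; [exact: Hdiv_L2..|exact: Hdiv_weak_div|exact: Hdiv_weak_div].
Qed.

(** Testing with v, then with z: (v, v) = (z, v) = (v, z) = (z, z). *)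
Lemma eq_norm2v_innerv v z : L2v Omega v -> L2v Omega z ->
  (forall y, L2v Omega y -> innerv Omega v y = innerv Omega z y) ->
  norm2v Omega v = norm2v Omega z.
Proof.
by move=> Lv Lz h; congr Num.sqrt; rewrite h// innervC h.
Qed.

Lemma H10B u w : H10 Omega u -> H10 Omega w -> H10 Omega (fun x => u x - w x).
Proof.
move=> [Hu cu] [Hw cw]; split; first exact: H1B.
move=> e e0; have e20 : 0 < e / 2 by rewrite divr_gt0.
have [phi [tphi phi1 phi2]] := cu _ e20.
have [psi [tpsi psi1 psi2]] := cw _ e20.
have Lphi := test_function_L2 mO bO tphi; have Lpsi := test_function_L2 mO bO tpsi.
have Ldphi := test_function_L2_grad mO bO tphi.
have Ldpsi := test_function_L2_grad mO bO tpsi.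
have tB := test_functionB tphi tpsi.
have LdB := test_function_L2_grad mO bO tB.
exists (phi - psi); split => //.
  rewrite (_ : (fun x => _) = (fun x => (u x - phi x) - (w x - psi x))).
    have L1 := L2B mO (H1_L2 Hu) Lphi; have L2 := L2B mO (H1_L2 Hw) Lpsi.
    apply: le_lt_trans (norm2_triangleB L1 L2) _.
    rewrite [ltRHS](splitr e); exact: ltrD phi1 psi1.
  by apply/funext => x; rewrite -[(phi - psi) x]/(phi x - psi x); ring.
have LuB := L2v_wgrad (H1B Hu Hw); have Lu := L2v_wgrad Hu; have Lw := L2v_wgrad Hw.
have LA := L2vB mO Lu Ldphi; have LB := L2vB mO Lw Ldpsi.
rewrite (@eq_norm2v_innerv _ (fun x => (wgrad Omega u x - grad phi x) -
    (wgrad Omega w x - grad psi x))).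
- apply: le_lt_trans (norm2v_triangleB mO LA LB) _.
  rewrite [ltRHS](splitr e); exact: ltrD phi2 psi2.
- exact: L2vB.
- exact: L2vB.
- move=> y Ly; rewrite !innervBl// innerv_wgradB//.
  rewrite (_ : grad (phi - psi) = fun x => grad phi x - grad psi x).
    by rewrite innervBl// !opprD addrACA.
  have [sphi _ _] := tphi; have [spsi _ _] := tpsi.
  by apply/funext => x; apply/rowP => i; rewrite !mxE pderivB.
Qed.

(** For a test function this is the definition of the weak divergence, and both sides are continuous
    in [w] for the H^1 norm. *)
Lemma green v w : Hdiv Omega v -> H10 Omega w ->
  innerv Omega v (wgrad Omega w) = - inner Omega (wdiv Omega v) w.
Proof.
move=> Hv [Hw cw]; have [Ldv wv] := Hdiv_weak_div Hv; have Lv := Hdiv_L2 Hv.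
have Lw := H1_L2 Hw; have Ldw := L2v_wgrad Hw.
apply/eqP; rewrite -addr_eq0; apply/eqP.
apply: (@le_eps_eq0 _ (norm2v Omega v + norm2 Omega (wdiv Omega v))).
  by rewrite addr_ge0 ?norm2v_ge0 ?norm2_ge0.
move=> e e0; have [phi [tphi phi1 phi2]] := cw _ e0.
have Lphi := test_function_L2 mO bO tphi.
have Ldphi := test_function_L2_grad mO bO tphi.
have -> : innerv Omega v (wgrad Omega w) + inner Omega (wdiv Omega v) w =
    innerv Omega v (fun x => wgrad Omega w x - grad phi x) +
    inner Omega (wdiv Omega v) (fun x => w x - phi x).
  by rewrite innervBr// innerBr// wv//; ring.
apply: le_trans (ler_normD _ _) _; rewrite mulrDr; apply: lerD.
  apply: le_trans (innerv_CauchySchwarz mO Lv (L2vB mO Ldw Ldphi)) _.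
  by rewrite mulrC ler_wpM2r ?norm2v_ge0// ltW.
apply: le_trans (inner_CauchySchwarz mO Ldv (L2B mO Lw Lphi)) _.
by rewrite mulrC ler_wpM2r ?norm2_ge0// ltW.
Qed.

Lemma norm2M_le f g (M : R) : 0 <= M -> L2 Omega f -> measurable_fun Omega g ->
  (forall x, Omega x -> `|g x| <= M) ->
  norm2 Omega (fun x => g x * f x) <= M * norm2 Omega f.
Proof.
move=> M0 Lf mg gM.
rewrite -(ger0_norm M0) -sqrtr_sqr -sqrtrM ?sqr_ge0//; apply: ler_wsqrtr.
have Lgf := L2M_bounded mO Lf mg gM.
rewrite -RintegralZl//; last exact: L2_integrableM.
apply: le_Rintegral => //.
- exact: L2_integrableM.
- exact: (integrableZl mO (M ^+ 2) (L2_integrableM mO Lf Lf)).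
- move=> x Ox; rewrite mulrACA ler_wpM2r -?expr2 ?sqr_ge0//.
  by rewrite -(real_normK (num_real (g x))) ler_pXn2r ?nnegrE ?gM.
Qed.

Lemma coord_diameter (i : 'I_d) x y : Omega x -> Omega y ->
  `|x 0 i - y 0 i| <= diameter Omega.
Proof.
move=> Ox Oy; apply: (@le_trans _ _ (enorm (x - y))).
  rewrite -sqrtr_sqr; apply: ler_wsqrtr; rewrite /dot (bigD1 i)//= !mxE -expr2 lerDl.
  by apply: sumr_ge0 => j _; rewrite -expr2 sqr_ge0.
apply: ub_le_sup; last by exists x => //; exists y.
have [M OM] := bounded_rV_cube bO.
exists (Num.sqrt (\sum_(j < d) (2 * M) ^+ 2)) => _ [a Oa [b Ob <-]].
apply: ler_wsqrtr; apply: ler_sum => j _; rewrite !mxE -expr2.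
have /andP[a1 a2] := OM _ Oa j; have /andP[b1 b2] := OM _ Ob j.
rewrite -(real_normK (num_real (a 0 j - b 0 j))) ler_pXn2r ?nnegrE//; last lra.
by rewrite ler_norml; apply/andP; split; lra.
Qed.

(* Testing the weak derivative with [(x_i - c) * phi] plays the role of an
   integration by parts of [(x_i - c) * w ^ 2]. *)
Lemma friedrichs (i : 'I_d) w : Omega !=set0 -> H10 Omega w ->
  norm2 Omega w <= 2 * diameter Omega * norm2v Omega (wgrad Omega w).
Proof.
move=> [x0 Ox0] [Hw cw].
have h0 : 0 <= diameter Omega.
  by have := coord_diameter i Ox0 Ox0; rewrite subrr normr0.
have [LG wG] := H1_weak_grad Hw; have Lw := H1_L2 Hw.
pose m : 'rV[R]_d -> R := cst (- x0 0 i) + (fun x : 'rV[R]_d => x 0 i).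
have sm : smooth m by apply: smoothD; [exact: smooth_cst|exact: smooth_coord].
have mm : measurable_fun Omega m.
  by apply: measurable_funTS; apply: continuous_measurable_rV; exact: smooth_continuous.
have mh x : Omega x -> `|m x| <= diameter Omega.
  by move=> Ox; rewrite /m -[(_ + _) x]/(- x0 0 i + x 0 i) addrC; exact: coord_diameter.
pose g x := wgrad Omega w x 0 i; have Lg : L2 Omega g by exact: LG.
have Lmw : L2 Omega (fun x => m x * w x) := L2M_bounded mO Lw mm mh.
have Lmg : L2 Omega (fun x => m x * g x) := L2M_bounded mO Lg mm mh.
(* The limit of the weak identity tested with m phi as phi tends to [w]; each error term is linear
   in w - phi or in its derivative, so Cauchy-Schwarz controls it. *)
have key : inner Omega w w + inner Omega (fun x => m x * w x) g +
    inner Omega (fun x => m x * g x) w = 0.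
  apply: (@le_eps_eq0 _ (norm2 Omega w + norm2 Omega (fun x => m x * w x) +
    norm2 Omega (fun x => m x * g x))); first by rewrite !addr_ge0 ?norm2_ge0.
  move=> e e0; have [phi [tphi phi1 phi2]] := cw _ e0; have [sphi _ _] := tphi.
  have Lphi := test_function_L2 mO bO tphi.
  have Ldphi := test_function_L2 mO bO (test_function_pderiv i tphi).
  have Lmdphi : L2 Omega (fun x => m x * pderiv i phi x) := L2M_bounded mO Ldphi mm mh.
  have LGphi := L2vB mO LG (test_function_L2_grad mO bO tphi).
  have := wG _ (test_functionM tphi sm) i; rewrite pderivM//.
  have -> : pderiv i m = cst 1.
    apply/funext => x; rewrite /pderiv.
    have [_ ->] := is_deriveD (is_derive_cst (- x0 0 i) x (delta_mx 0 i))
      (is_derive_coord i i x).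
    by rewrite eqxx add0r.
  have -> : inner Omega w (m * pderiv i phi + phi * cst 1) =
      inner Omega (fun x => m x * w x) (pderiv i phi) + inner Omega w phi.
    rewrite /inner -RintegralD//; [|exact: L2_integrableM..].
    apply: eq_Rintegral => x _.
    rewrite -[(_ + _) x in LHS]/(m x * pderiv i phi x + phi x * 1); ring.
  have -> : inner Omega g (m * phi) = inner Omega (fun x => m x * g x) phi.
    apply: eq_Rintegral => x _; rewrite -[(_ * _) x in LHS]/(m x * phi x); ring.
  move=> wphi.
  have -> : inner Omega w w + inner Omega (fun x => m x * w x) g +
    inner Omega (fun x => m x * g x) w = inner Omega w (fun x => w x - phi x) +
    inner Omega (fun x => m x * w x) (fun x => g x - pderiv i phi x) +
    inner Omega (fun x => m x * g x) (fun x => w x - phi x).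
    rewrite !innerBr//; lra.
  have CS f f' : L2 Omega f -> L2 Omega f' -> norm2 Omega f' < e ->
      `|inner Omega f f'| <= e * norm2 Omega f.
    move=> Lf Lf' f'e; apply: le_trans (inner_CauchySchwarz mO Lf Lf') _.
    by rewrite mulrC ler_wpM2r ?norm2_ge0// ltW.
  apply: le_trans (ler_normD _ _) _; rewrite mulrDr; apply: lerD; last first.
    by apply: CS => //; exact: L2B.
  apply: le_trans (ler_normD _ _) _; rewrite mulrDr; apply: lerD.
    by apply: CS => //; exact: L2B.
  apply: CS => //; first exact: L2B.
  apply: le_lt_trans phi2; apply: le_trans (norm2_coord_le mO i LGphi).
  rewrite le_eqVlt; apply/orP; left; apply/eqP; congr norm2.
  by apply/funext => x; rewrite !mxE.
have := inner_CauchySchwarz mO Lmw Lg.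
(* The two cross terms of [key] coincide, whence the half, and the factor 2 of the inequality. *)
have -> : inner Omega (fun x => m x * w x) g = - (norm2 Omega w ^+ 2 / 2).
  have E : inner Omega (fun x => m x * g x) w = inner Omega (fun x => m x * w x) g.
    by apply: eq_Rintegral => x _; ring.
  by move: key; rewrite sqr_norm2 E; lra.
have gG : norm2 Omega g <= norm2v Omega (wgrad Omega w) := norm2_coord_le mO i LG.
have mw := norm2M_le h0 Lw mm mh.
rewrite normrN ger0_norm; last by rewrite divr_ge0 ?sqr_ge0.
have := norm2_ge0 Omega g; have := norm2_ge0 Omega w.
have := norm2_ge0 Omega (fun x => m x * w x).
move: (norm2 _ (fun x => m x * w x)) (norm2 _ w) (norm2 _ g) (norm2v _ _)
  (diameter _) h0 gG mw.
move=> a b c k h h0 ck ah a0 b0 c0 bac.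
have [->|bn0] := eqVneq b 0; first by rewrite !mulr_ge0// (le_trans c0).
have bp : 0 < b by rewrite lt_neqAle eq_sym bn0.
rewrite -(ler_pM2l bp); have : a * c <= h * b * k by apply: ler_pM.
by move: bac; rewrite expr2; lra.
Qed.

End sobolev.

(** * Differences of discrete functions and the scalar energy estimate *)

Section quasi_optimality.
Context {R : realType} {d : nat} (Omega : set 'rV[R]_d) (T : seq 'M[R]_(d.+1, d)).
Hypotheses (oO : open Omega) (bO : bounded_set Omega).

Let mO : measurable Omega := measurable_open_rV oO.

Lemma PmB m f g : Pm Omega T m f -> Pm Omega T m g ->
  Pm Omega T m (fun x => f x - g x).
Proof.
move=> [Lf fK] [Lg gK]; split; first exact: L2B.
move=> K KT; have [P degP fP] := fK _ KT; have [Q degQ gQ] := gK _ KT.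
exists (P - Q); first by apply: degree_leD => //; exact: degree_leN.
apply: filterS2 fP gQ => x fx gx Kx.
by rewrite fx// gx// /polyfun mpoly.mevalB.
Qed.

Lemma RTNB p v w : RTN Omega T p v -> RTN Omega T p w ->
  RTN Omega T p (fun x => v x - w x).
Proof.
move=> [Lv vK] [Lw wK]; split; first exact: L2vB.
move=> K KT; have [P [Q [degP degQ vP]]] := vK _ KT.
have [P' [Q' [degP' degQ' wP]]] := wK _ KT.
exists (fun i => P i - P' i), (Q - Q'); split.
- by move=> i; apply: degree_leD => //; exact: degree_leN.
- by apply: degree_leD => //; exact: degree_leN.
- apply: filterS2 vP wP => x vx wx Kx; rewrite vx// wx//.
  apply/rowP => i; rewrite !mxE /polyfun !mpoly.mevalB; ring.
Qed.

(** Here t = |eps + grad delta|, D = h |div eps|, x = |eps| and y = |grad delta|. The first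
    inequality gives t <= S and, since S t - t^2 <= S^2 / 4, also 2 D <= S. Completing the square in
    the second gives x^2 + (y - 2 D)^2 <= t^2 + 4 D^2 <= 2 S^2, hence x <= 2 S and y <= 2 S + 2 D <=
    3 S. *)
Lemma energy_bound (S t D x y : R) : 0 <= S -> 0 <= t -> 0 <= D -> 0 <= x -> 0 <= y ->
  t ^+ 2 + D ^+ 2 <= S * t -> x ^+ 2 + y ^+ 2 <= t ^+ 2 + 4 * D * y ->
  x + y <= 5 * S.
Proof.
move=> S0 t0 D0 x0 y0 tD xy.
have tS : t <= S.
  have [->//|tn0] := eqVneq t 0.
  have tp : 0 < t by rewrite lt_neqAle eq_sym tn0.
  by rewrite -(ler_pM2r tp); have := sqr_ge0 D; rewrite -expr2; lra.
have StS : S * t <= S ^+ 2 by rewrite expr2 ler_wpM2l.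
have DS : 2 * D <= S.
  rewrite -(ler_pXn2r (n := 2)) ?nnegrE//; last by lra.
  by have := sqr_ge0 (2 * t - S); nra.
have xS : x <= 2 * S.
  rewrite -(ler_pXn2r (n := 2)) ?nnegrE//; last by lra.
  by have := sqr_ge0 (y - 2 * D); have := sqr_ge0 t; nra.
have yS : y - 2 * D <= 2 * S.
  apply: le_trans (ler_norm _) _.
  rewrite -(ler_pXn2r (n := 2)) ?nnegrE//; last by lra.
  rewrite real_normK ?num_real//.
  by have := sqr_ge0 x; have := sqr_ge0 t; nra.
lra.
Qed.

End quasi_optimality.

(** The bound passes to one infimum at a time. Extended reals cover an empty set, whose infimum is
    +oo; nonnegativity excludes -oo and with it an ill-defined sum. *)
Lemma le_mul_ereal_inf_add (R : realType) (C x : R) (A B : set \bar R) : 0 < C ->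
  (forall a, A a -> 0 <= a)%E -> (forall b, B b -> 0 <= b)%E ->
  (forall a b, A a -> B b -> x%:E <= C%:E * (a + b))%E ->
  (x%:E <= C%:E * (ereal_inf A + ereal_inf B))%E.
Proof.
move=> C0 A0 B0 h.
have iA0 : (0 <= ereal_inf A)%E by exact: le_ereal_inf_tmp.
have iB0 : (0 <= ereal_inf B)%E by exact: le_ereal_inf_tmp.
rewrite muleC -lee_pdivrMr// -EFinM; set y := x / C.
have {}h a b : A a -> B b -> (y%:E <= a + b)%E.
  by move=> Aa Bb; rewrite EFinM lee_pdivrMr// muleC h.
move: (ereal_inf A) (@le_ereal_inf_tmp R A) (iA0) => [r| |] infA // _; last first.
  by rewrite addye ?leey// gt_eqF// (lt_le_trans _ iB0)// ltNyr.
rewrite -leeBlDl// -EFinB; apply: le_ereal_inf_tmp => -[b| |] Bb; last 2 first.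
- by rewrite leey.
- by have := B0 _ Bb.
rewrite lee_fin lerBlDr -lerBlDl -lee_fin; apply: infA => -[a| |] Aa.
- by rewrite lee_fin lerBlDl -lee_fin EFinD addeC h.
- by rewrite leey.
- by have := A0 _ Aa.
Qed.

(** The letters a, b, c, e, v, w are pairings of sigma, grad u, sigma_LS, grad u_LS, v, grad w, with
    eps (index 1) or grad delta (index 2); d1, d2, d3 pair div eps with the divergences of sigma,
    sigma_LS, v. The hypotheses are the four variational equations and the projection property. *)
Lemma galerkin_identity (R : realType)
    (a1 a2 b1 b2 c1 c2 e1 e2 v1 v2 w1 w2 d1 d2 d3 fD h2 : R) :
  a2 + b2 = 0 -> c2 + e2 = 0 -> h2 * d1 + (a1 + b1) = h2 * fD ->
  h2 * d2 + (c1 + e1) = h2 * fD -> d1 - d3 = 0 ->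
  a1 - v1 + (a2 - v2) + (b1 - w1 + (b2 - w2)) =
  c1 - v1 + (c2 - v2) + (e1 - w1 + (e2 - w2)) + h2 * (d2 - d3).
Proof. by move=> E1 E2 E3 E4 E5; have -> : d3 = d1; lra. Qed.

(** [e] is (div eps, delta), bounded by Cauchy-Schwarz followed by Friedrichs. *)
Lemma energy_bound_hyp (R : realType) (t x y e D h : R) :
  t ^+ 2 = x ^+ 2 + y ^+ 2 - 2 * e -> e <= D * (2 * h * y) ->
  x ^+ 2 + y ^+ 2 <= t ^+ 2 + 4 * (h * D) * y.
Proof. by move=> -> eD; lra. Qed.

Lemma total_bound (R : realType) (a b x y : R) :
  x + y <= 5 * (a + b) -> a + x + (b + y) <= 6 * (a + b).
Proof. by lra. Qed.

Lemma sqrD_identity (R : realType) (a b c : R) : a + - b + (- b + c) = a + c - 2 * b.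
Proof. by ring. Qed.

(** * Quasi-optimality in an abstract Galerkin setting *)

Section galerkin.
Opaque inner innerv norm2 norm2v wgrad wdiv.
Context {R : realType} {d : nat} (Omega : set 'rV[R]_d).
Hypotheses (oO : open Omega) (bO : bounded_set Omega) (neO : Omega !=set0).
Variable i0 : 'I_d.
Variables (V : set ('rV[R]_d -> 'rV[R]_d)) (U : set ('rV[R]_d -> R)).
Hypotheses (VH : V `<=` Hdiv Omega) (UH : U `<=` H10 Omega).
Variables (f : 'rV[R]_d -> R) (sigmaLS sigma v : 'rV[R]_d -> 'rV[R]_d)
  (uLS u w : 'rV[R]_d -> R).
Hypotheses
  (hLS : least_squares_solution Omega f V U sigmaLS uLS)
  (hsol : least_squares_solution Omega f (Hdiv Omega) (H10 Omega) sigma u).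
Let eps x := sigmaLS x - v x.
Let del x := uLS x - w x.
Hypotheses (Vv : V v) (Uw : U w) (Veps : V eps) (Udel : U del)
  (proj : inner Omega (fun x => wdiv Omega sigma x - wdiv Omega v x)
    (wdiv Omega eps) = 0).

Let mO : measurable Omega := measurable_open_rV oO.

(** The discrete spaces enter only through conformity, the membership of eps and delta, and the
    orthogonality [proj]; meshes and polynomials are left to the final theorem. *)
Lemma galerkin_quasi_optimality :
  norm2v Omega (fun x => sigma x - sigmaLS x)
    + norm2v Omega (wgrad Omega (fun x => u x - uLS x)) <=
  6 * (norm2v Omega (fun x => sigma x - v x)
    + norm2v Omega (wgrad Omega (fun x => u x - w x))).
Proof.
have [HsLS Hu_ orthLS eqLS] := hLS; have [Hs Hu orth eq] := hsol.
have HdsLS := VH HsLS; have HdV := VH Vv; have Hdeps := VH Veps.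
have [HuLS _] := UH Hu_; have [Hu1 _] := Hu; have [Hw _] := UH Uw.
have [Hdel _] := UH Udel.
have LsLS := Hdiv_L2 HdsLS; have Ls := Hdiv_L2 Hs; have Lv := Hdiv_L2 HdV.
have Leps := Hdiv_L2 Hdeps.
have LguLS := L2v_wgrad HuLS; have Lgu := L2v_wgrad Hu1; have Lgw := L2v_wgrad Hw.
have Lgdel := L2v_wgrad Hdel.
have Huw := H1B oO bO Hu1 Hw; have Lguw := L2v_wgrad Huw.
have HuuLS := H1B oO bO Hu1 HuLS; have LguuLS := L2v_wgrad HuuLS.
have LD := L2_wdiv Hdeps; have Ldel := H1_L2 Hdel.
have Lsv := L2vB mO Ls Lv.
have LX := L2vD mO Leps Lgdel.
pose h := diameter Omega.
have h0 : 0 <= h.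
  by have [x Ox] := neO; have := coord_diameter bO i0 Ox Ox; rewrite subrr normr0.
pose D := wdiv Omega eps; pose gd := wgrad Omega del.
pose ge := wgrad Omega (fun x => u x - w x).
pose sv x := sigma x - v x; pose X x := eps x + gd x.
have epsE z : L2v Omega z -> innerv Omega eps z = innerv Omega sigmaLS z - innerv Omega v z.
  exact: innervBl.
have svE z : L2v Omega z -> innerv Omega sv z = innerv Omega sigma z - innerv Omega v z.
  exact: innervBl.
have gdE z : L2v Omega z -> innerv Omega gd z =
    innerv Omega (wgrad Omega uLS) z - innerv Omega (wgrad Omega w) z.
  exact: innerv_wgradB.
have geE z : L2v Omega z -> innerv Omega ge z =
    innerv Omega (wgrad Omega u) z - innerv Omega (wgrad Omega w) z.
  exact: innerv_wgradB.
(* By conformity, the continuous equations may be tested with the same discrete delta and eps as the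
   discrete ones. *)
have E1 := orth _ (UH Udel); have E2 := orthLS _ Udel.
have E3 := eq _ Hdeps; have E4 := eqLS _ Veps.
rewrite innervDl// -/gd in E1; rewrite innervDl// -/gd in E2.
rewrite innervDl// -/D in E3; rewrite innervDl// -/D in E4.
have E5 := proj; rewrite innerBl// -/D in E5; [|exact: L2_wdiv..].
have E6 : inner Omega D D = inner Omega (wdiv Omega sigmaLS) D - inner Omega (wdiv Omega v) D.
  exact: inner_wdivB.
have E7 : innerv Omega eps gd = - inner Omega D del := green oO bO Hdeps (UH Udel).
have F : norm2 Omega del <= 2 * h * norm2v Omega gd := friedrichs oO bO i0 neO (UH Udel).
have CS1 := innerv_CauchySchwarz mO Lsv LX; have CS2 := innerv_CauchySchwarz mO Lguw LX.
have CS3 := inner_CauchySchwarz mO LD Ldel.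
have XE z : L2v Omega z -> innerv Omega z X = innerv Omega z eps + innerv Omega z gd.
  by move=> Lz; exact: innervDr.
have svX : innerv Omega sv X + innerv Omega ge X =
    norm2v Omega X ^+ 2 + (h * norm2 Omega D) ^+ 2.
  rewrite exprMn sqr_norm2 sqr_norm2v [innerv Omega X X]innervDl//.
  rewrite !XE// !svE// !geE// !epsE// !gdE// E6.
  move: E1 E2 E3 E4 E5; rewrite -/h.
  exact: galerkin_identity.
have X2 : norm2v Omega X ^+ 2 = norm2v Omega eps ^+ 2 + norm2v Omega gd ^+ 2
    - 2 * inner Omega D del.
  rewrite !sqr_norm2v [innerv Omega X X]innervDl// !XE// (innervC _ gd eps) E7.
  exact: sqrD_identity.
have errs : norm2v Omega (fun x => sigma x - sigmaLS x) <= norm2v Omega sv + norm2v Omega eps.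
  apply: le_trans (norm2v_triangleB mO Lsv Leps).
  rewrite le_eqVlt; apply/orP; left; apply/eqP; congr norm2v.
  by apply/funext => x; rewrite /sv /eps opprB addrA subrK.
have erru : norm2v Omega (wgrad Omega (fun x => u x - uLS x)) <=
    norm2v Omega ge + norm2v Omega gd.
  apply: le_trans (norm2v_triangleB mO Lguw Lgdel).
  rewrite le_eqVlt; apply/orP; left; apply/eqP.
  (* The gradient of u - u_LS agrees with the difference of the two fields only after pairing,
     unlike the flux error above, where the functions are equal. *)
  apply: eq_norm2v_innerv => //; first exact: L2vB.
  move=> z Lz; rewrite (innerv_wgradB oO bO Hu1 HuLS Lz).
  by rewrite (innervBl mO Lguw Lgdel Lz) (geE z Lz) (gdE z Lz) opprB addrA subrK.
have SX := le_trans (lerD (ler_norm _) (ler_norm _)) (lerD CS1 CS2).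
rewrite -/X -/sv -/ge svX in SX.
have Dd := le_trans (ler_norm _) CS3.
have hyp2 : norm2v Omega eps ^+ 2 + norm2v Omega gd ^+ 2 <=
    norm2v Omega X ^+ 2 + 4 * (h * norm2 Omega D) * norm2v Omega gd.
  apply: energy_bound_hyp X2 (le_trans Dd (ler_wpM2l (norm2_ge0 Omega D) F)).
rewrite -mulrDl in SX.
have h1 := energy_bound (addr_ge0 (norm2v_ge0 Omega sv) (norm2v_ge0 Omega ge))
  (norm2v_ge0 Omega X) (mulr_ge0 h0 (norm2_ge0 Omega D)) (norm2v_ge0 Omega eps)
  (norm2v_ge0 Omega gd) SX hyp2.
apply: le_trans (lerD errs erru) _.
exact: total_bound.
Qed.

End galerkin.

Theorem lemma6p2 (R : realType) :
  exists2 C : R, C <= 17 &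
  forall (d : nat) (hd : d = 2%N \/ d = 3%N)
    (Omega : set 'rV[R]_d) (hOmega : polytopal_domain Omega)
    (T : seq 'M[R]_(d.+1, d)) (hT : conforming_mesh Omega T)
    (p q : nat) (hq : (1 <= q)%N)
    (f : 'rV[R]_d -> R) (hf : L2 Omega f)
    (sigmaLS : 'rV[R]_d -> 'rV[R]_d) (uLS : 'rV[R]_d -> R)
    (hLS : least_squares_solution Omega f
       (RTN Omega T p `&` Hdiv Omega) (Pm Omega T q `&` H10 Omega) sigmaLS uLS)
    (sigma : 'rV[R]_d -> 'rV[R]_d) (u : 'rV[R]_d -> R)
    (hsol : least_squares_solution Omega f (Hdiv Omega) (H10 Omega) sigma u),
  ((norm2v Omega (fun x => sigma x - sigmaLS x)
    + norm2v Omega (wgrad Omega (fun x => u x - uLS x)))%:E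
   <= C%:E *
     (ereal_inf [set (norm2v Omega (fun x => sigma x - v x))%:E |
        v in [set v | (RTN Omega T p `&` Hdiv Omega) v /\
                      is_L2_projection Omega T p (wdiv Omega sigma)
                        (wdiv Omega v)]]
      + ereal_inf [set (norm2v Omega (wgrad Omega (fun x => u x - w x)))%:E |
          w in Pm Omega T q `&` H10 Omega]))%E.
Proof.
exists 6; first by rewrite ler_nat.
move=> d hd Omega hOmega T hT p q hq f hf sigmaLS uLS hLS sigma u hsol.
(* Friedrichs' inequality is taken along one coordinate direction, so one must exist. *)
have d_gt0 : (0 < d)%N by case: hd => ->.
have oO := domain_open hOmega; have bO := domain_bounded hOmega.
have neO := domain_nonempty hOmega.
have [[RsLS HsLS] [PuLS HuLS] _ _] := hLS.
apply: le_mul_ereal_inf_add => //.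
- by move=> _ [v _ <-]; rewrite lee_fin; exact: norm2v_ge0.
- by move=> _ [w _ <-]; rewrite lee_fin; exact: norm2v_ge0.
move=> _ _ [v [[Rv Hv] [_ proj]] <-] [w [Pw Hw] <-].
have Reps := RTNB oO RsLS Rv; have Heps := HdivB oO bO HsLS Hv.
rewrite lee_fin; apply: (galerkin_quasi_optimality oO bO neO (Ordinal d_gt0) _ _ hLS hsol).
- by move=> ? [].
- by move=> ? [].
- by split.
- by split.
- by split.
- by split; [exact: PmB|exact: H10B].
(* div eps is a piecewise polynomial of degree p by [RTN_weak_div], so the projection error of div
   sigma is orthogonal to it. *)
- apply: proj; apply: (RTN_weak_div oO bO (mesh_nondegenerate hT) Reps).
  exact: Hdiv_weak_div.
Qed.
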